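(* Let $(\phi_h^0,s_h^0,\mathbf u_h^0)\in\mathcal V_h\times\mathcal V_h\times\mathcal X_h$ be given and let $(\phi_h^{n+1},\mu_h^{n+1},s_h^{n+1},\vartheta_h^{n+1},\mathbf u_h^{n+1},p_h^{n+1})\in\mathcal V_h\times\mathcal V_h\times\mathcal V_h\times\mathcal V_h\times\mathcal X_h\times\mathcal Q_h$, $n=0,\dots,n_T-1$, be solutions of the fully discrete scheme (S1)–(S6) written out in the context, with $\vartheta_h^{k}>0$ on $\Omega$ for all $k=1,\dots,n_T$. Then for every $n\in\{0,\dots,n_T-1\}$: (i) (mass conservation) if $N\equiv0$, then $\langle\phi_h^{n+1},1\rangle=\langle\phi_h^0,1\rangle$; (ii) (exact entropy production) $$\langle s_h^{n+1},1\rangle=\langle s_h^0,1\rangle+\tau\sum_{k=0}^{n}\mathcal P^{k+1},$$ where $$\mathcal P^{k+1}=\int_\Omega M_h^{k+1/2}\Big|\nabla\tfrac{\mu_h^{k+1}}{\vartheta_h^{k+1}}\Big|^2+N_h^{k+1/2}\Big|\tfrac{\mu_h^{k+1}}{\vartheta_h^{k+1}}\Big|^2+K_h^{k+1/2}\Big|\nabla\tfrac1{\vartheta_h^{k+1}}\Big|^2+\tfrac{\eta_h^{k+1/2}}{\vartheta_h^{k+1}}\big|\mathrm D\mathbf u_h^{k+1/2}\big|^2;$$ (iii) (total energy conservation) $$\Big\langle e(\phi_h^{n+1},\nabla\phi_h^{n+1},s_h^{n+1})+\tfrac12|\mathbf u_h^{n+1}|^2,1\Big\rangle=\Big\langle e(\phi_h^{0},\nabla\phi_h^{0},s_h^{0})+\tfrac12|\mathbf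 u_h^{0}|^2,1\Big\rangle.$$
   Context: **Domain and notation.** $\Omega=[0,L_1]\times\dots\times[0,L_d]$, $d\in\{1,2,3\}$, is identified with the $d$-dimensional torus; all functions are periodic. $\langle a,b\rangle=\int_\Omega a\,b$ (with the Euclidean/Frobenius product for vectors/matrices). $\mathrm D\mathbf u=\frac12(\nabla\mathbf u+\nabla\mathbf u^\top)$ is the symmetric gradient, $\mathbf I$ the identity matrix, and $$c_{\mathrm{skw}}(\mathbf u,\mathbf u,\mathbf v)=\tfrac12\langle(\mathbf u\cdot\nabla)\mathbf u,\mathbf v\rangle-\tfrac12\langle(\mathbf u\cdot\nabla)\mathbf v,\mathbf u\rangle .$$ **Constitutive data.** $M,N,K,\eta$ are non-negative real-valued functions of $(\phi,\vartheta)$. The potential $f:\mathbb R\times\mathbb R_+\to\mathbb R$ is smooth, strictly concave in $\vartheta$ for each fixed $\phi$, and goes to infinity for $\vartheta\to0$; $\kappa:\mathbb R_+\to\mathbb R_+$ is (differentiable and) concave. The Helmholtz free energy is $F(\phi,\nabla\phi,\vartheta)=f(\phi,\vartheta)+\frac{\kappa(\vartheta)}2|\nabla\phi|^2$, the entropy is $s=-\partial_\vartheta F(\phi,\nabla\phi,\vartheta)$, and the internal energy is $e=F+\vartheta s$. Since $F$ is strictly concave in $\vartheta$, the relation $s=-\partial_\vartheta F(\phi,\nabla\phi,\vartheta)$ can be inverted for $\vartheta$, and $e$ is regarded as a function $e(\phi,\nabla\phi,s)$ of the independent variables $(\phi,\nabla\phi,s)$; $\partial_\phi e,\partial_{\nabla\phi}e,\partial_s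 e$ denote its partial derivatives in these variables. It is understood that all arguments at which $e$ and its derivatives are evaluated lie in the domain of $e$. The Korteweg stress is $\boldsymbol\sigma=\kappa(\vartheta)\nabla\phi\otimes\nabla\phi$. **Spaces.** $\mathcal T_h$ is a conforming partition of $\Omega$ into simplices, extendable periodically, and (with periodicity understood) $\mathcal V_h=\{v\in H^1(\Omega)\cap C^0(\bar\Omega): v|_T\in P_1(T)\ \forall T\in\mathcal T_h\}$, $\mathcal X_h=\{v\in H^1(\Omega)^d\cap C^0(\bar\Omega)^d: v|_T\in P_2(T)^d\ \forall T\in\mathcal T_h\}$, $\mathcal Q_h=\{v\in\mathcal V_h:\langle v,1\rangle=0\}$. **Time grid.** $[0,T]$ is split uniformly with step $\tau>0$, $t^n=n\tau$, $n_T=T/\tau\in\mathbb N$. Set $\partial_t^\tau g^{n+1}=\frac{g^{n+1}-g^n}\tau$ and $g^{n+1/2}=\frac{g^{n+1}+g^n}2$. For $X\in\{M,N,K,\eta\}$ set $X_h^{n+1/2}=X(\phi_h^{n+1/2},\vartheta_h^{n+1})$, and $\boldsymbol\sigma_h^{n+1/2}=\kappa(\vartheta_h^{n+1})\nabla\phi_h^{n+1/2}\otimes\nabla\phi_h^{n+1/2}$. Let $I_1^\tau g(\ell)=\frac{g^{n+1}-g^n}\tau(\ell-t^n)+g^n$ for $\ell\in[t^n,t^{n+1}]$, and for $a\in\{\phi,\nabla\phi,s\}$ define the time averages $$\overline{\partial_a e}^{\,n+1}=\frac1\tau\int_{t^n}^{t^{n+1}}\partial_a e\big(I_1^\tau\phi_h(\ell),\nabla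 I_1^\tau\phi_h(\ell),I_1^\tau s_h(\ell)\big)\,\mathrm d\ell .$$ **Scheme.** For $n=0,\dots,n_T-1$, for all $(\psi,\zeta,\omega,\chi,\mathbf v,q)\in\mathcal V_h\times\mathcal V_h\times\mathcal V_h\times\mathcal V_h\times\mathcal X_h\times\mathcal Q_h$: (S1) $\langle\partial_t^\tau\phi_h^{n+1},\psi\rangle-\langle\phi_h^{n+1/2}\mathbf u_h^{n+1/2},\nabla\psi\rangle+\langle M_h^{n+1/2}\nabla\frac{\mu_h^{n+1}}{\vartheta_h^{n+1}},\nabla\psi\rangle+\langle N_h^{n+1/2}\frac{\mu_h^{n+1}}{\vartheta_h^{n+1}},\psi\rangle=0$; (S2) $\langle\mu_h^{n+1},\zeta\rangle-\langle\overline{\partial_\phi e}^{\,n+1},\zeta\rangle-\langle\overline{\partial_{\nabla\phi}e}^{\,n+1},\frac1{\vartheta_h^{n+1}}\nabla(\zeta\vartheta_h^{n+1})\rangle=0$; (S3) $\langle\partial_t^\tau s_h^{n+1},\omega\rangle-\langle s_h^{n+1/2}\mathbf u_h^{n+1/2},\nabla\omega\rangle-\langle\eta_h^{n+1/2}|\mathrm D\mathbf u_h^{n+1/2}|^2,\frac{\omega}{\vartheta_h^{n+1}}\rangle-\langle K_h^{n+1/2}\nabla\frac1{\vartheta_h^{n+1}},\nabla\frac{\omega}{\vartheta_h^{n+1}}\rangle-\langle M_h^{n+1/2}\nabla\frac{\mu_h^{n+1}}{\vartheta_h^{n+1}},\nabla\frac{\omega\mu_h^{n+1}}{\vartheta_h^{n+1}}\rangle-\langle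 N_h^{n+1/2}\frac{\mu_h^{n+1}}{\vartheta_h^{n+1}},\frac{\omega\mu_h^{n+1}}{\vartheta_h^{n+1}}\rangle-\langle\partial_t^\tau\phi_h^{n+1}\,\overline{\partial_{\nabla\phi}e}^{\,n+1}+\boldsymbol\sigma_h^{n+1/2}\mathbf u_h^{n+1/2},\frac1{\vartheta_h^{n+1}}\nabla\omega\rangle=0$; (S4) $\langle\vartheta_h^{n+1},\chi\rangle-\langle\overline{\partial_s e}^{\,n+1},\chi\rangle=0$; (S5) $\langle\partial_t^\tau\mathbf u_h^{n+1},\mathbf v\rangle+c_{\mathrm{skw}}(\mathbf u_h^{n+1/2},\mathbf u_h^{n+1/2},\mathbf v)+\langle\eta_h^{n+1/2}\mathrm D\mathbf u_h^{n+1/2},\mathrm D\mathbf v\rangle-\langle p_h^{n+1},\operatorname{div}\mathbf v\rangle+\langle\phi_h^{n+1/2}\nabla\mu_h^{n+1}+(\frac1{\vartheta_h^{n+1}}\boldsymbol\sigma_h^{n+1/2}+s_h^{n+1/2}\mathbf I)\nabla\vartheta_h^{n+1},\mathbf v\rangle=0$; (S6) $\langle\operatorname{div}\mathbf u_h^{n+1/2},q\rangle=0$. *)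

(* Defs.v *)
From HB Require Import structures.
From mathcomp Require Import all_boot all_order all_algebra.
From mathcomp Require Import all_classical all_reals all_analysis.
From mathcomp Require Import measurable_realfun.
Import numFieldNormedType.Exports.
Set Implicit Arguments.
Unset Strict Implicit.
Unset Printing Implicit Defensive.
Import Order.TTheory GRing.Theory Num.Theory.
Local Open Scope classical_set_scope.
Local Open Scope ring_scope.

(* Borel sigma-algebra on matrices; R^d is 'rV[R]_d. *)
Section borel_matrix.
Context (R : realType) (m n : nat).
HB.instance Definition _ := @isMeasurable.Build default_measure_display
  'M[R]_(m, n) <<s @open 'M[R]_(m, n) >>
  (@sigma_algebra0 _ setT _) (@sigma_algebraC _ _) (@sigma_algebra_bigcup _ setT _).
End borel_matrix.

Lemma measurable_fun_mx (R : realType) (m n : nat) dT (T : measurableType dT)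
    (f : T -> 'M[R]_(m, n)) :
  (forall i j, measurable_fun setT (fun x => f x i j)) -> measurable_fun setT f.
Proof.
move=> mf; apply: (@measurability _ _ _ _ _ _ (@open 'M[R]_(m, n))) => //.
move=> _ [U oU <-]; rewrite setTI.
pose B (qk : 'M[rat]_(m, n) * nat) : set 'M[R]_(m, n) :=
  [set y | forall i j, ball (ratr (qk.1 i j) : R) (qk.2.+1%:R^-1) (y i j)].
have mB qk : measurable (f @^-1` B qk).
  rewrite [X in measurable X](_ : _ = \bigcap_(ij in [set: 'I_m * 'I_n])
      ((fun x => f x ij.1 ij.2) @^-1` ball (ratr (qk.1 ij.1 ij.2) : R) (qk.2.+1%:R^-1))).
    apply: fin_bigcap_measurable => //.
    move=> -[i j] _; rewrite -[X in measurable X]setTI; apply: mf => //.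
    exact: measurable_ball.
  apply/seteqP; split=> [x Bx [i j] _|x Bx i j]; first exact: Bx.
  exact: (Bx (i, j)).
rewrite [X in measurable X](_ : _ =
    \bigcup_qk (if `[< B qk `<=` U >] then f @^-1` B qk else set0)); last first.
  apply/seteqP; split=> [x Ufx|x [qk _]]; last first.
    by case: asboolP => // BU; exact: BU.
  have /nbhs_ballP[e /= e0 eU] : nbhs (f x) U by exact: open_nbhs_nbhs.
  pose k := Num.truncn ((e / 2)^-1).
  have k1 : k.+1%:R^-1 < e / 2.
    rewrite invf_plt ?posrE ?divr_gt0//; exact: truncnS_gt.
  have /choice[q qP] (ij : 'I_m * 'I_n) : exists q : rat,
      ball (ratr q : R) (k.+1%:R^-1) (f x ij.1 ij.2).
    have ne : ball (f x ij.1 ij.2) (k.+1%:R^-1 : R) !=set0.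
      by exists (f x ij.1 ij.2); exact: ballxx.
    have [y [fq [q _ qE]]] := @dense_rat R _ ne (ball_open _ _).
    by exists q; apply: ball_sym; rewrite qE.
  exists (\matrix_(i, j) q (i, j), k) => //.
  have Bx : B (\matrix_(i, j) q (i, j), k) (f x).
    by move=> i j /=; rewrite mxE; exact: (qP (i, j)).
  case: asboolP => // -[] y By; apply: eU; split=> // i j.
  rewrite (splitr e); apply: (@le_ball _ _ _ (k.+1%:R^-1 + k.+1%:R^-1)).
    by rewrite lerD// ltW.
  have := By i j; rewrite /= mxE => yq.
  apply: ball_triangle yq; exact: ball_sym (qP (i, j)).
apply: countable_bigcupT_measurable => //.
by move=> qk; case: ifP.
Qed.


Lemma measurable_coord (R : realType) m n (i : 'I_m) (j : 'I_n) :
  measurable_fun setT (fun A : 'M[R]_(m, n) => A i j).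
Proof.
apply: (measurability _ (RGenOpens.measurableE R)) => _ [_ [a [b ->]] <-].
rewrite setTI; apply: sub_sigma_algebra; apply: open_comp; last exact: interval_open.
by move=> A _; exact: coord_continuous.
Qed.

Section lebesgue_rV.
Context (R : realType).

Definition rVcons d (x : measurableTypeR R * 'rV[R]_d) : 'rV[R]_d.+1 :=
  row_mx (const_mx x.1 : 'rV_1) x.2.

Lemma measurable_rVcons d : measurable_fun setT (@rVcons d).
Proof.
apply: measurable_fun_mx => i j.
have -> : (fun x => @rVcons d x i j) = match fintype.split (j : 'I_(1 + d)) with
    | inl _ => fst | inr k => fun x => x.2 i k end.
  by apply/funext => x; rewrite /rVcons mxE; case: fintype.split => // k; rewrite mxE.
case: (fintype.split _) => [_|k]; first exact: measurable_fst.
apply: (@measurableT_comp _ _ _ _ _ _ (fun A : 'rV[R]_d => A i k) _ snd) => //.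
exact: measurable_coord.
Qed.


Definition lebesgue_rV_step d (m : set 'rV[R]_d -> \bar R) : set 'rV[R]_d.+1 -> \bar R :=
  pushforward (lebesgue_measure \x m)%E (@rVcons d).

Section step.
Context d (m : {sigma_finite_measure set 'rV[R]_d -> \bar R}).

Let step0 : lebesgue_rV_step m set0 = 0%E.
Proof.
unshelve apply: (@measure0 _ _ _ (pushforward (lebesgue_measure \x m)%E (@rVcons d))).
exact: measurable_rVcons.
Qed.

Let step_ge0 A : (0 <= lebesgue_rV_step m A)%E.
Proof.
unshelve apply: (@measure_ge0 _ _ _ (pushforward (lebesgue_measure \x m)%E (@rVcons d))).
exact: measurable_rVcons.
Qed.

Let step_sigma_additive : semi_sigma_additive (lebesgue_rV_step m).
Proof.
unshelve apply: (@measure_semi_sigma_additive _ _ _ (pushforward (lebesgue_measure \x m)%E (@rVcons d))).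
exact: measurable_rVcons.
Qed.

HB.instance Definition _ := isMeasure.Build _ _ _ (lebesgue_rV_step m)
  step0 step_ge0 step_sigma_additive.

Let step_sigma_finite : sigma_finite setT (lebesgue_rV_step m).
Proof.
have /sigma_finiteP[F [FT ndF mF]] := sigma_finiteT (@lebesgue_measure R).
have /sigma_finiteP[G [GT ndG mG]] := sigma_finiteT m.
pose g (v : 'rV[R]_d.+1) : measurableTypeR R * 'rV[R]_d := (v 0 0, \row_j v 0 (lift 0 j)).
have gK : cancel (@rVcons d) g.
  move=> [a v]; rewrite /g /rVcons; congr pair.
    by rewrite mxE; case: fintype.splitP => // k; rewrite mxE.
  apply/rowP => j; rewrite !mxE; case: fintype.splitP => [[[]//]|k /=].
  by rewrite add1n => -[] /val_inj ->.
have Kg : cancel g (@rVcons d).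
  move=> v; apply/rowP => j; rewrite mxE; case: fintype.splitP => k jk; rewrite !mxE.
    by congr (v _ _); apply: val_inj; rewrite /= jk; case: k jk => -[].
  by congr (v _ _); apply: val_inj; rewrite /= jk.
have mg : measurable_fun setT g.
  apply/measurable_fun_pairP; split; first exact: measurable_coord.
  apply: measurable_fun_mx => i j.
  by under eq_fun do rewrite /= mxE; exact: measurable_coord.
exists (fun n => g @^-1` (F n `*` G n)).
  apply/seteqP; split=> // v _; rewrite -preimage_bigcup /preimage/=.
  have [n _ Fn] : (\bigcup_i F i) (g v).1 by rewrite -FT.
  have [k _ Gk] : (\bigcup_i G i) (g v).2 by rewrite -GT.
  exists (maxn n k) => //; split.
    by move: Fn; exact/subsetPset/ndF/leq_maxl.
  by move: Gk; exact/subsetPset/ndG/leq_maxr.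
move=> n; have [mFn Fnoo] := mF n; have [mGn Gnoo] := mG n; split.
  by rewrite -[X in measurable X]setTI; apply: mg => //; exact: measurableX.
rewrite /lebesgue_rV_step /pushforward -comp_preimage.
rewrite (_ : g \o _ = id) ?preimage_id; last exact/funext.
by rewrite product_measure1E// lte_mul_pinfty// ge0_fin_numE.
Qed.

HB.instance Definition _ := Measure_isSigmaFinite.Build _ _ _
  (lebesgue_rV_step m) step_sigma_finite.

End step.

(* Lebesgue measure on R^d, as the d-fold product of lebesgue_measure. *)
Fixpoint lebesgue_rV d : {sigma_finite_measure set 'rV[R]_d -> \bar R} :=
  match d with
  | 0 => \d_(0 : 'rV[R]_0)
  | d'.+1 => lebesgue_rV_step (lebesgue_rV d')
  end.

End lebesgue_rV.

Section calculus.
Context (R : realType) (d : nat).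
Implicit Types (g : 'rV[R]_d -> R) (v w : 'rV[R]_d -> 'rV[R]_d).

Definition dot m n (A B : 'M[R]_(m, n)) : R := \sum_i \sum_j A i j * B i j.

Definition matvec m (A : 'M[R]_m) (a : 'rV[R]_m) : 'rV[R]_m := (A *m a^T)^T.

(* Pointwise gradient; it is used only where the argument is differentiable,
   i.e. off the boundaries of the elements for finite element functions. *)
Definition grad g (x : 'rV[R]_d) : 'rV[R]_d := \row_j 'D_(delta_mx 0 j) g x.

Definition jac v (x : 'rV[R]_d) : 'M[R]_d :=
  \matrix_(i, j) 'D_(delta_mx 0 j) (fun y => v y 0 i) x.

Definition div v (x : 'rV[R]_d) : R := \tr (jac v x).

Definition symgrad v (x : 'rV[R]_d) : 'M[R]_d := 2^-1 *: (jac v x + (jac v x)^T).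

(* (v . grad) w *)
Definition advect v w (x : 'rV[R]_d) : 'rV[R]_d := matvec (jac w x) (v x).

End calculus.

(* C^k on an open set A: all iterated directional derivatives up to order k
   exist and are continuous on A. *)
Fixpoint Ck_on (R : realType) (V : normedModType R) (A : set V) (k : nat)
    (g : V -> R) : Prop :=
  (forall x, A x -> {for x, continuous g}) /\
  if k is k'.+1 then
    forall v, (forall x, A x -> derivable g x v) /\ Ck_on A k' (fun x => 'D_v g x)
  else True.

Definition smooth_on (R : realType) (V : normedModType R) (A : set V) (g : V -> R) :=
  forall k, Ck_on A k g.

Section torus.
Context (R : realType) (d : nat).
Variable L : 'rV[R]_d.

Definition Omega : set 'rV[R]_d := [set x | forall i, 0 <= x 0 i <= L 0 i].

(* Functions on the torus are functions on R^d with period L_i in direction i. *)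
Definition periodic (g : 'rV[R]_d -> R) :=
  forall x i, g (x + L 0 i *: delta_mx 0 i) = g x.

Definition L2 (g : 'rV[R]_d -> R) :=
  measurable_fun Omega g /\
  (\int[lebesgue_rV R d]_(x in Omega) ((g x) ^+ 2)%:E < +oo)%E.

(* H^1 of the torus, as the closure of the smooth periodic functions in the
   H^1 norm; G is the weak gradient of g. *)
Definition H1 (g : 'rV[R]_d -> R) :=
  L2 g /\ exists2 G : 'rV[R]_d -> 'rV[R]_d,
    forall i, L2 (fun x => G x 0 i) &
    forall eps : R, 0 < eps -> exists w : 'rV[R]_d -> R,
      [/\ smooth_on setT w, periodic w,
          (\int[lebesgue_rV R d]_(x in Omega) ((g x - w x) ^+ 2)%:E < eps%:E)%E &
          forall i, (\int[lebesgue_rV R d]_(x in Omega)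
                       ((G x 0 i - grad w x 0 i) ^+ 2)%:E < eps%:E)%E].

End torus.

Section mesh.
Context (R : realType) (d : nat).
Implicit Types (a b : 'I_d.+1 -> 'rV[R]_d) (S : {set 'I_d.+1}).

Definition affinely_independent a :=
  forall c : 'I_d.+1 -> R,
    \sum_i c i = 0 -> \sum_i c i *: a i = 0 -> forall i, c i = 0.

(* The face of the simplex with vertices a spanned by the vertices in S; the
   whole simplex for S = setT, and empty for S = set0. *)
Definition face a S : set 'rV[R]_d :=
  [set x | exists c : 'I_d.+1 -> R,
     [/\ forall i, 0 <= c i, forall i, i \notin S -> c i = 0,
         \sum_i c i = 1 & x = \sum_i c i *: a i]].

Definition simplex a : set 'rV[R]_d := face a [set: 'I_d.+1]%SET.

Definition meet_conformingly a b :=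
  exists S S', simplex a `&` simplex b = face a S /\ face a S = face b S'.

Context (I : finType).

Definition translate (L : 'rV[R]_d) (z : 'I_d -> int) a : 'I_d.+1 -> 'rV[R]_d :=
  fun i => a i + \row_j ((z j)%:~R * L 0 j).

(* A conforming partition of Omega into simplices whose translates by the
   period lattice still fit together conformingly. *)
Definition periodic_conforming_mesh (L : 'rV[R]_d) (mesh : I -> 'I_d.+1 -> 'rV[R]_d) :=
  [/\ forall i, affinely_independent (mesh i),
      forall i j, simplex (mesh i) = simplex (mesh j) -> i = j,
      \bigcup_i simplex (mesh i) = Omega L &
      forall i j z, meet_conformingly (mesh i) (translate L z (mesh j))].

(* The restriction of g to A is a polynomial of total degree at most k. *)
Definition is_poly_on (k : nat) (A : set 'rV[R]_d) (g : 'rV[R]_d -> R) :=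
  exists c : {ffun 'I_d -> 'I_k.+1} -> R, forall x, A x ->
    g x = \sum_(al : {ffun 'I_d -> 'I_k.+1} | (\sum_i al i <= k)%N)
            c al * \prod_i x 0 i ^+ al i.

(* Omega without the boundaries of the elements, which form a null set.  The
   derivatives of finite element functions exist there, and coincide with the
   weak ones; off this set they carry no information. *)
Definition elements (mesh : I -> 'I_d.+1 -> 'rV[R]_d) : set 'rV[R]_d :=
  \bigcup_i interior (simplex (mesh i)).

End mesh.

Section spaces.
Context (R : realType) (d : nat) (I : finType).
Variables (L : 'rV[R]_d) (mesh : I -> 'I_d.+1 -> 'rV[R]_d).

Definition integrable_h (g : 'rV[R]_d -> R) :=
  (lebesgue_rV R d).-integrable (elements mesh) (EFin \o g).

(* The integral over Omega of a function defined off the element boundaries. *)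
Definition int_h (g : 'rV[R]_d -> R) : R :=
  \int[lebesgue_rV R d]_(x in elements mesh) g x.

(* An equation between integrals over Omega: the integrals exist and their sum
   vanishes.  Existence is part of the equation because the coefficients
   M, N, K, eta are arbitrary non-negative functions. *)
Definition balance (gs : seq ('rV[R]_d -> R)) :=
  (forall i, (i < size gs)%N -> integrable_h (nth (cst 0) gs i)) /\
  \sum_(g <- gs) int_h g = 0.

Definition lagrange (k : nat) (g : 'rV[R]_d -> R) :=
  [/\ periodic L g, H1 L g, continuous g &
      forall i, is_poly_on k (simplex (mesh i)) g].

Definition Vh (g : 'rV[R]_d -> R) := lagrange 1 g.

Definition Xh (v : 'rV[R]_d -> 'rV[R]_d) := forall i, lagrange 2 (fun x => v x 0 i).

Definition Qh (g : 'rV[R]_d -> R) := Vh g /\ int_h g = 0.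

End spaces.

(* R_+ is the set of positive reals: functions of the temperature are only
   constrained on it. *)
Section thermodynamics.
Context (R : realType) (d : nat).
Variables (f : R -> R -> R) (kappa : R -> R).

Definition concave_on_pos (g : R -> R) :=
  forall a b t, 0 < a -> 0 < b -> 0 <= t <= 1 ->
    t * g a + (1 - t) * g b <= g (t * a + (1 - t) * b).

Definition strictly_concave_on_pos (g : R -> R) :=
  forall a b t, 0 < a -> 0 < b -> a != b -> 0 < t < 1 ->
    t * g a + (1 - t) * g b < g (t * a + (1 - t) * b).

(* A concave function on ]0, +oo[ is bounded above near 0, so that f can only
   blow up to -oo there; hence the absolute value. *)
Definition admissible_potential :=
  [/\ smooth_on [set z : R * R | 0 < z.2] (fun z => f z.1 z.2),
      forall a, strictly_concave_on_pos (f a) &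
      forall a, `|f a t| @[t --> 0^'+] --> +oo].

Definition admissible_kappa :=
  [/\ forall t, 0 < t -> 0 <= kappa t, forall t, 0 < t -> derivable kappa t 1 &
      concave_on_pos kappa].

Definition helmholtz (a : R) (b : 'rV[R]_d) (t : R) : R :=
  f a t + kappa t / 2 * dot b b.

Definition entropy (a : R) (b : 'rV[R]_d) (t : R) : R :=
  - (helmholtz a b)^`()%classic t.

Definition temperatures (a : R) (b : 'rV[R]_d) (c : R) : set R :=
  [set t | 0 < t /\ c = entropy a b t].

Definition energy_domain (a : R) (b : 'rV[R]_d) (c : R) :=
  temperatures a b c !=set0.

(* The inverse of the entropy in the temperature; 1 is a dummy value off the
   domain. *)
Definition temperature (a : R) (b : 'rV[R]_d) (c : R) : R :=
  xget 1 (temperatures a b c).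

Definition internal_energy (a : R) (b : 'rV[R]_d) (c : R) : R :=
  helmholtz a b (temperature a b c) + temperature a b c * c.

Definition denergy_phi (a : R) (b : 'rV[R]_d) (c : R) : R :=
  (fun a' => internal_energy a' b c)^`()%classic a.

Definition denergy_grad (a : R) (b : 'rV[R]_d) (c : R) : 'rV[R]_d :=
  grad (fun b' => internal_energy a b' c) b.

Definition denergy_s (a : R) (b : 'rV[R]_d) (c : R) : R :=
  (internal_energy a b)^`()%classic c.

End thermodynamics.

Section scheme.
Context (R : realType) (d : nat) (I : finType).
Variables (L : 'rV[R]_d) (mesh : I -> 'I_d.+1 -> 'rV[R]_d).
Variables (f : R -> R -> R) (kappa : R -> R) (M N K eta : R -> R -> R).
Variable tau : R.

Section time.
Context (W : normedModType R).
Implicit Types g : nat -> 'rV[R]_d -> W.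

(* dtau g n and mid g n are the values at the times n+1 and n+1/2. *)
Definition dtau g n x : W := tau^-1 *: (g n.+1 x - g n x).

Definition mid g n x : W := 2^-1 *: (g n.+1 x + g n x).

Definition tgrid (n : nat) : R := n%:R * tau.

Definition interp g n (l : R) x : W :=
  ((l - tgrid n) / tau) *: (g n.+1 x - g n x) + g n x.

End time.

Variables (phi mu s theta p : nat -> 'rV[R]_d -> R) (u : nat -> 'rV[R]_d -> 'rV[R]_d).

Definition state_in_domain n (l : R) x :=
  energy_domain f kappa (interp phi n l x) (grad (interp phi n l) x) (interp s n l x).

Definition time_mean n (e' : R -> 'rV[R]_d -> R -> R) x : R :=
  tau^-1 * \int[lebesgue_measure]_(l in `[tgrid n, tgrid n.+1])
    e' (interp phi n l x) (grad (interp phi n l) x) (interp s n l x).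

Definition mean_e_phi n x : R := time_mean n (denergy_phi f kappa) x.

Definition mean_e_s n x : R := time_mean n (denergy_s f kappa) x.

Definition mean_e_grad n x : 'rV[R]_d :=
  \row_i time_mean n (fun a b c => denergy_grad f kappa a b c 0 i) x.

Definition coef (X : R -> R -> R) n x : R := X (mid phi n x) (theta n.+1 x).

Definition korteweg n x : 'M[R]_d :=
  kappa (theta n.+1 x) *: ((grad (mid phi n) x)^T *m grad (mid phi n) x).

Definition mu_theta n x : R := mu n.+1 x / theta n.+1 x.

Definition eq_phase n := forall psi, Vh L mesh psi -> balance mesh
  [:: (fun x => dtau phi n x * psi x);
      (fun x => - dot (mid phi n x *: mid u n x) (grad psi x));
      (fun x => dot (coef M n x *: grad (mu_theta n) x) (grad psi x));
      (fun x => coef N n x * mu_theta n x * psi x)].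

Definition eq_potential n := forall zeta, Vh L mesh zeta -> balance mesh
  [:: (fun x => mu n.+1 x * zeta x);
      (fun x => - (mean_e_phi n x * zeta x));
      (fun x => - dot (mean_e_grad n x)
                  ((theta n.+1 x)^-1 *: grad (fun y => zeta y * theta n.+1 y) x))].

Definition eq_entropy n := forall omega, Vh L mesh omega -> balance mesh
  [:: (fun x => dtau s n x * omega x);
      (fun x => - dot (mid s n x *: mid u n x) (grad omega x));
      (fun x => - (coef eta n x * dot (symgrad (mid u n) x) (symgrad (mid u n) x)
                   * (omega x / theta n.+1 x)));
      (fun x => - dot (coef K n x *: grad (fun y => 1 / theta n.+1 y) x)
                  (grad (fun y => omega y / theta n.+1 y) x));
      (fun x => - dot (coef M n x *: grad (mu_theta n) x)
                  (grad (fun y => omega y * mu n.+1 y / theta n.+1 y) x));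
      (fun x => - (coef N n x * mu_theta n x
                   * (omega x * mu n.+1 x / theta n.+1 x)));
      (fun x => - dot (dtau phi n x *: mean_e_grad n x
                       + matvec (korteweg n x) (mid u n x))
                  ((theta n.+1 x)^-1 *: grad omega x))].

Definition eq_temperature n := forall chi, Vh L mesh chi -> balance mesh
  [:: (fun x => theta n.+1 x * chi x);
      (fun x => - (mean_e_s n x * chi x))].

(* The second and third terms are c_skw(u, u, v) for u = mid u n. *)
Definition eq_momentum n := forall v, Xh L mesh v -> balance mesh
  [:: (fun x => dot (dtau u n x) (v x));
      (fun x => 2^-1 * dot (advect (mid u n) (mid u n) x) (v x));
      (fun x => - (2^-1 * dot (advect (mid u n) v x) (mid u n x)));
      (fun x => dot (coef eta n x *: symgrad (mid u n) x) (symgrad v x));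
      (fun x => - (p n.+1 x * div v x));
      (fun x => dot (mid phi n x *: grad (mu n.+1) x
                     + matvec ((theta n.+1 x)^-1 *: korteweg n x + (mid s n x)%:M)
                         (grad (theta n.+1) x))
                (v x))].

Definition eq_divergence n := forall q, Qh L mesh q -> balance mesh
  [:: (fun x => div (mid u n) x * q x)].

Definition solves_scheme n :=
  [/\ eq_phase n, eq_potential n, eq_entropy n & eq_temperature n] /\
  (eq_momentum n /\ eq_divergence n).

Definition entropy_production n : R :=
  int_h mesh (fun x =>
      coef M n x * dot (grad (mu_theta n) x) (grad (mu_theta n) x)
    + coef N n x * `|mu_theta n x| ^+ 2
    + coef K n x * dot (grad (fun y => 1 / theta n.+1 y) x)
                       (grad (fun y => 1 / theta n.+1 y) x)
    + coef eta n x / theta n.+1 x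
        * dot (symgrad (mid u n) x) (symgrad (mid u n) x)).

Definition total_energy_density n x : R :=
  internal_energy f kappa (phi n x) (grad (phi n) x) (s n x)
  + 2^-1 * dot (u n x) (u n x).

End scheme.

(* Main.v *)
(**
  Testing the scheme with psi = mu, zeta = dtau phi, omega = theta, chi = dtau s, v = mid u and
  q = p and adding the six equations (the second and the fourth with a minus sign) makes all
  fluxes, dissipation and capillary terms cancel pointwise on every element.  What is left is the
  increment of the kinetic energy plus the time averages of the partial derivatives of e paired
  with the increments of phi, grad phi and s, which by the fundamental theorem of calculus along
  the interpolating segment is the increment of e.  Constants as test functions give the mass and
  the entropy balance.

  The chain rule needs no regularity of the temperature beyond continuity: since s = - dF/dtheta
  at the maximizer of the strictly concave function t |-> F(phi, grad phi, t) + t s, the internal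
  energy is the maximal value of that function, and the envelope theorem differentiates it in
  (phi, grad phi, s) with the temperature frozen.
*)
Require Import Defs.
From mathcomp Require Import all_boot all_order all_algebra.
From mathcomp Require Import all_classical all_reals all_analysis.
From mathcomp Require Import measurable_realfun ring lra.
Import numFieldNormedType.Exports.
Import Order.TTheory GRing.Theory Num.Theory.
Set Implicit Arguments.
Unset Strict Implicit.
Unset Printing Implicit Defensive.
Local Open Scope classical_set_scope.
Local Open Scope ring_scope.

(** * The envelope theorem *)

(** The first-order expansion contains no quotient and allows [h = 0], so derivatives can be read
    off from upper and lower bounds on an increment. *)
Lemma is_derive1P (R : realType) (g : R -> R) (t a : R) :
  is_derive t 1 g a <->
  forall e, 0 < e -> \forall h \near 0, `|g (t + h) - g t - a * h| <= e * `|h|.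
Proof.
have E : (is_derive t 1 g a) <->
    ((fun h => h^-1 *: (g (h *: 1 + t) - g t)) @ 0^' --> a).
  split=> [[dg <-]|Ha]; first exact: dg.
  apply: DeriveDef; first by apply/cvg_ex; exists a.
  exact: cvg_lim Ha.
rewrite E; split=> H.
  move=> e e0; move/cvgrPdist_le : H => /(_ e e0); rewrite near_withinE.
  apply: filterS => h; have [->|h0 /(_ isT)] := eqVneq h 0.
    by rewrite addr0 subrr mulr0 subr0 !normr0 mulr0.
  rewrite [h *: 1]mulr1 [t + h]addrC => Hh.
  have -> : g (h + t) - g t - a * h = - ((a - h^-1 *: (g (h + t) - g t)) * h).
    by rewrite /GRing.scale/=; field.
  by rewrite normrN normrM ler_wpM2r.
apply/cvgrPdist_le => e e0; have := H e e0.
rewrite near_withinE; apply: filterS => h Hh h0.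
rewrite [h *: 1]mulr1 [h + t]addrC.
have -> : a - h^-1 *: (g (t + h) - g t) = - ((g (t + h) - g t - a * h) / h).
  by rewrite /GRing.scale/=; field.
rewrite normrN normrM normfV ler_pdivrMr//; by rewrite normr_gt0.
Qed.

(** If [g t >= g t0], strict concavity puts the midpoint [m] strictly above [g t0]. Near [t0] the
    graph then lies above the chord from [t0] to [m], whose slope is nonzero, and this contradicts
    the zero derivative. *)
Lemma strictly_concave_critical_lt (R : realType) (g : R -> R) (t0 t : R) :
  strictly_concave_on_pos g -> 0 < t0 -> is_derive t0 1 g 0 ->
  0 < t -> t != t0 -> g t < g t0.
Proof.
move=> cg t00 /is_derive1P dg tp tt0; rewrite ltNge; apply/negP => gt.
pose m := 2^-1 * t + (1 - 2^-1) * t0.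
have gm : g t0 < g m.
  have h01 : 0 < (2^-1 : R) < 1 by apply/andP; split; lra.
  have := cg t t0 2^-1 tp t00 tt0 h01; rewrite -/m; lra.
have m0 : 0 < m by rewrite /m; lra.
have mt0 : m != t0.
  apply: contra tt0 => /eqP; rewrite /m => ?; apply/eqP; lra.
pose w := m - t0.
have w0 : 0 < `|w| by rewrite normr_gt0 subr_eq0.
(* The tolerance is the absolute slope of the chord from [t0] to [m], so the derivative bound reads
   [g (t0 + la * w) - g t0 <= la * (g m - g t0)], the reverse of strict concavity. *)
have e0 : 0 < (g m - g t0) / `|w| by rewrite divr_gt0// subr_gt0.
have [r /= r0 Hr] := (nbhs_ballP _ _).1 (dg _ e0).
(* The second bound keeps [t0 + la * w] in the ball of radius [r]; the first keeps [la] below 1. *)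
pose la := Num.min 2^-1 (r / 2 / `|w|).
have la0 : 0 < la by rewrite /la lt_min; apply/andP; split; [lra|rewrite !divr_gt0].
have la1 : la < 1 by rewrite /la gt_min; apply/orP; left; lra.
have lar : la * `|w| < r.
  have : la <= r / 2 / `|w| by rewrite /la ge_min lexx orbT.
  by rewrite ler_pdivlMr// => ?; lra.
have := Hr (la * w); rewrite /ball/= sub0r normrN normrM (gtr0_norm la0) => /(_ lar).
rewrite mul0r subr0 => Hw.
have := cg m t0 la m0 t00 mt0; rewrite la0 la1 => /(_ isT).
have -> : la * m + (1 - la) * t0 = t0 + la * w by rewrite /w; ring.
move=> c; move: Hw; rewrite mulrCA divfK ?gt_eqF//.
move=> /(le_trans (ler_norm _)); lra.
Qed.

(** Maximality squeezes the increment of [G h (T h)] between the increments of [G] in its first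
    argument alone, with the second frozen at [T h0] (below) and at [T h] (above). The mean value
    theorem and the joint continuity of [Gh] compare both with [Gh h0 (T h0) * (h - h0)]. *)
Lemma envelope_is_derive (R : realType) (G Gh : R -> R -> R) (T : R -> R) (h0 : R) :
  (forall h t : R, 0 < t -> is_derive h 1 (G ^~ t) (Gh h t)) ->
  {for (h0, T h0), continuous (fun z => Gh z.1 z.2)} ->
  {for h0, continuous T} ->
  (\forall h \near h0, 0 < T h /\ forall t : R, 0 < t -> G h t <= G h (T h)) ->
  is_derive h0 1 (fun h => G h (T h)) (Gh h0 (T h0)).
Proof.
move=> dG cGh cT nT; apply/is_derive1P => e e0.
(* The mean value theorem in the first argument at frozen [t], on whichever side of [h0] the point
   [h] lies. *)
have bd h t : 0 < t -> (forall k, `|k - h0| <= `|h - h0| -> `|Gh k t - Gh h0 (T h0)| <= e) ->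
    `|G h t - G h0 t - Gh h0 (T h0) * (h - h0)| <= e * `|h - h0|.
  move=> t0 H.
  have ctn a b : {within `[a, b], continuous (G ^~ t)}.
    by apply: derivable_within_continuous => x _; have [] := dG x t t0.
  have [hh|hh|->] := ltgtP h h0; last by rewrite !subrr mulr0 subrr normr0 mulr0.
  - have [c + cE] := MVT hh (fun x _ => dG x t t0) (ctn _ _).
    rewrite in_itv/= => /andP[hc ch].
    have -> : G h t - G h0 t - Gh h0 (T h0) * (h - h0) = (Gh c t - Gh h0 (T h0)) * (h - h0).
      by move: cE => /=; lra.
    by rewrite normrM ler_wpM2r// H// !ltr0_norm ?subr_lt0//; lra.
  - have [c + cE] := MVT hh (fun x _ => dG x t t0) (ctn _ _).
    rewrite in_itv/= => /andP[hc ch].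
    have -> : G h t - G h0 t - Gh h0 (T h0) * (h - h0) = (Gh c t - Gh h0 (T h0)) * (h - h0).
      by move: cE => /=; lra.
    by rewrite normrM ler_wpM2r// H// !gtr0_norm ?subr_gt0//; lra.
have /cvgrPdist_le/(_ e e0)/nbhs_ballP[r /= r0 Hr] := cGh.
have near_T : \forall h \near h0, `|T h - T h0| < r.
  by move/cvgrPdist_lt : cT => /(_ r r0); apply: filterS => h; rewrite distrC.
have [T00 maxT0] := nbhs_singleton nT.
have /nbhs_ballP[r' /= r'0 Hr'] : \forall h \near h0,
    [/\ `|h - h0| < r, `|T h - T h0| < r, 0 < T h & forall t : R, 0 < t -> G h t <= G h (T h)].
  near=> h; have [? ?] : 0 < T h /\ forall t : R, 0 < t -> G h t <= G h (T h) by near: h.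
  by split=> //; near: h.
apply/nbhs_ballP; exists r' => //= k; rewrite /ball/= sub0r normrN => kr'.
have /Hr'[] : ball h0 r' (h0 + k) by rewrite /ball/= opprD addNKr normrN.
set h := h0 + k; have hk : h - h0 = k by rewrite /h addrC addKr.
move=> hr Tr Th0 maxTh.
have ctrl t : `|t - T h0| < r -> forall l, `|l - h0| <= `|h - h0| ->
    `|Gh l t - Gh h0 (T h0)| <= e.
  move=> tr l lh; rewrite distrC; apply: (Hr (l, t)).
  by split; rewrite /ball/= distrC//; exact: le_lt_trans hr.
have := bd h (T h) Th0 (ctrl _ Tr).
have := bd h (T h0) T00 (ctrl _ _); rewrite subrr normr0 => /(_ r0).
rewrite hk !ler_norml => /andP[lo _] /andP[_ up].
have := maxTh _ T00; have := maxT0 _ Th0.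
by move=> ? ?; apply/andP; split; lra.
Unshelve. all: by end_near. Qed.

(* Near [h0] the maximizer of [G h] over a segment around [T h0] is interior, hence critical. *)
Lemma maximizer_continuous (R : realType) (G : R -> R -> R) (T : R -> R) (h0 : R) :
  (forall h, strictly_concave_on_pos (G h)) ->
  (forall h t : R, 0 < t -> derivable (G h) t 1) ->
  (forall t : R, 0 < t -> {for h0, continuous (G ^~ t)}) ->
  (forall h, (exists2 t : R, 0 < t & is_derive t 1 (G h) 0) ->
    0 < T h /\ is_derive (T h) 1 (G h) 0) ->
  (exists2 t : R, 0 < t & is_derive t 1 (G h0) 0) ->
  {for h0, continuous T} /\
  \forall h \near h0, 0 < T h /\ forall t : R, 0 < t -> G h t <= G h (T h).
Proof.
move=> scG dG cG HT ex0; have [T00 dT0] := HT _ ex0.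
have maxT h : (exists2 t : R, 0 < t & is_derive t 1 (G h) 0) ->
    0 < T h /\ forall t : R, 0 < t -> G h t <= G h (T h).
  move=> /HT[Th0 dTh]; split=> // t t0; have [->//|tT] := eqVneq t (T h).
  exact/ltW/(strictly_concave_critical_lt (scG h) Th0 dTh).
(* The bound [e < T h0] keeps the segment of radius [e] around [T h0] inside the positive reals,
   where [G h] is concave and derivable. *)
have loc e : 0 < e -> e < T h0 ->
    \forall h \near h0, (exists2 t : R, 0 < t & is_derive t 1 (G h) 0) /\ `|T h0 - T h| < e.
  move=> e0 eT.
  pose t1 := T h0 - e; pose t2 := T h0 + e.
  have t10 : 0 < t1 by rewrite subr_gt0.
  have t20 : 0 < t2 by rewrite addr_gt0.
  have G1 : G h0 t1 < G h0 (T h0).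
    by apply: strictly_concave_critical_lt => //; rewrite /t1; apply/eqP; lra.
  have G2 : G h0 t2 < G h0 (T h0).
    by apply: strictly_concave_critical_lt => //; rewrite /t2; apply/eqP; lra.
  have near_lt t : 0 < t -> G h0 t < G h0 (T h0) -> \forall h \near h0, G h t < G h (T h0).
    move=> t0 Gt; have : \forall h \near h0, 0 < G h (T h0) - G h t.
      have c : (fun h => G h (T h0) - G h t) @ h0 --> G h0 (T h0) - G h0 t.
        by apply: cvgB; apply: cG.
      by apply: (cvgr_gt _ c); rewrite subr_gt0.
    by apply: filterS => h /=; rewrite subr_gt0.
  near=> h.
  have H1 : G h t1 < G h (T h0) by near: h; exact: near_lt.
  have H2 : G h t2 < G h (T h0) by near: h; exact: near_lt.
  have t12 : t1 <= t2 by rewrite /t1 /t2; lra.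
  have cGh : {within `[t1, t2], continuous (G h)}.
    apply: derivable_within_continuous => x; rewrite in_itv/= => /andP[x1 _].
    by apply: dG; exact: lt_le_trans x1.
  (* At both end points [G h] is strictly below its value at [T h0], first for [h0] and then by
     continuity for [h] near [h0]. Hence the maximum point [c] is interior. *)
  have [c + cmax] := EVT_max t12 cGh.
  rewrite in_itv/= => /andP[c1 c2].
  have Tin : T h0 \in `[t1, t2] by rewrite in_itv/=; apply/andP; split; rewrite /t1 /t2; lra.
  have cT := cmax _ Tin.
  have c1' : t1 < c by rewrite lt_neqAle c1 andbT; apply/eqP => cE; rewrite -cE in cT; lra.
  have c2' : c < t2 by rewrite lt_neqAle c2 andbT; apply/eqP => cE; rewrite cE in cT; lra.
  have c0 : 0 < c by exact: lt_trans c1'.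
  have dc : is_derive c 1 (G h) 0.
    apply: (@derive1_at_max _ _ t1 t2) => //.
    - by move=> t; rewrite in_itv/= => /andP[? _]; apply: dG; lra.
    - by rewrite in_itv/= c1' c2'.
    - move=> t; rewrite in_itv/= => /andP[? ?].
      by apply: cmax; rewrite in_itv/=; apply/andP; split; lra.
  split; first by exists c.
  have [Th0 dTh] := HT h (ex_intro2 _ _ c c0 dc).
  (* Both points are critical for [G h]; if they differed, each value would be strictly below the
     other. *)
  have -> : T h = c.
    apply/eqP; apply: contraT => Tc.
    have := strictly_concave_critical_lt (scG h) c0 dc Th0 Tc.
    rewrite eq_sym in Tc.
    have := strictly_concave_critical_lt (scG h) Th0 dTh c0 Tc; lra.
  by rewrite ltr_norml; apply/andP; split; move: c1' c2'; rewrite /t1 /t2; lra.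
split.
  apply/cvgrPdist_lt => e e0.
  pose e' := Num.min e (T h0 / 2).
  have e'0 : 0 < e' by rewrite lt_min e0/= divr_gt0.
  have e'T : e' < T h0 by rewrite gt_min; apply/orP; right; lra.
  apply: filterS (loc _ e'0 e'T) => h [_ /lt_le_trans]; apply.
  by rewrite ge_min lexx.
have eT : T h0 / 2 < T h0 by lra.
have e0 : 0 < T h0 / 2 by lra.
by apply: filterS (loc _ e0 eT) => h [/maxT].
Unshelve. all: by end_near. Qed.

(** * The internal energy along a line *)

Section dot.
Context (R : realType) (m n : nat).
Implicit Types A B C : 'M[R]_(m, n).

Lemma dotC A B : dot A B = dot B A.
Proof. by apply: eq_bigr => i _; apply: eq_bigr => j _; rewrite mulrC. Qed.

Lemma dotDl A B C : dot (A + B) C = dot A C + dot B C.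
Proof.
rewrite /dot -big_split/=; apply: eq_bigr => i _.
by rewrite -big_split/=; apply: eq_bigr => j _; rewrite mxE mulrDl.
Qed.

Lemma dotZl (k : R) A B : dot (k *: A) B = k * dot A B.
Proof.
rewrite /dot mulr_sumr; apply: eq_bigr => i _.
by rewrite mulr_sumr; apply: eq_bigr => j _; rewrite mxE mulrA.
Qed.

Lemma dotDr A B C : dot A (B + C) = dot A B + dot A C.
Proof. by rewrite dotC dotDl !(dotC A). Qed.

Lemma dotZr (k : R) A B : dot A (k *: B) = k * dot A B.
Proof. by rewrite dotC dotZl dotC. Qed.

Lemma dotNl A B : dot (- A) B = - dot A B.
Proof. by rewrite -scaleN1r dotZl mulN1r. Qed.

Lemma dotNr A B : dot A (- B) = - dot A B.
Proof. by rewrite dotC dotNl dotC. Qed.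

Lemma dot0l A : dot 0 A = 0.
Proof. by rewrite -[0](scale0r A) dotZl mul0r. Qed.

Lemma dot0r A : dot A 0 = 0.
Proof. by rewrite dotC dot0l. Qed.

Lemma dot_ge0 A : 0 <= dot A A.
Proof. by apply: sumr_ge0 => i _; apply: sumr_ge0 => j _; rewrite -expr2 sqr_ge0. Qed.

End dot.

Lemma dot_delta (R : realType) (n : nat) (b : 'rV[R]_n) (j : 'I_n) :
  dot b (delta_mx 0 j) = b 0 j.
Proof.
rewrite /dot big_ord1 (bigD1 j)//= mxE !eqxx mulr1 big1 ?addr0// => i ij.
by rewrite mxE (negbTE ij) andbF mulr0.
Qed.

(** The derivative of [f] in its first variable is taken as a directional derivative on pairs,
    because in this form [smooth_on] yields both its existence and its joint continuity. *)
Definition dpotential (R : realType) (f : R -> R -> R) (a t : R) : R :=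
  'D_((1, 0) : R * R) (fun z : R * R => f z.1 z.2) (a, t).

Section energy.
Context (R : realType) (d : nat).
Variables (f : R -> R -> R) (kappa : R -> R).
Hypotheses (hf : admissible_potential f) (hk : admissible_kappa kappa).

Let fpair := fun z : R * R => f z.1 z.2.

Lemma is_derive_potential_phi (a t : R) : 0 < t -> is_derive a 1 (f ^~ t) (dpotential f a t).
Proof.
move=> t0; have [/(_ 1%N)[_ /(_ (1, 0))[D1 _]] _ _] := hf.
have := D1 (a, t) t0; rewrite /derivable => D.
have E : (fun h : R => h^-1 *: (f (h *: 1 + a) t - f a t)) =
    (fun h : R => h^-1 *: (fpair (h *: (1, 0) + (a, t)) - fpair (a, t))).
  apply/funext => h; congr (_ *: (_ - _)); rewrite /fpair/=.
  by rewrite scaler0 add0r.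
apply: DeriveDef; first by rewrite /derivable E.
by rewrite /dpotential /derive E.
Qed.

Lemma derivable_potential (a t : R) : 0 < t -> derivable (f a) t 1.
Proof.
move=> t0; have [/(_ 1%N)[_ /(_ (0, 1))[D1 _]] _ _] := hf.
have := D1 (a, t) t0; rewrite /derivable => D.
have E : (fun h : R => h^-1 *: (f a (h *: 1 + t) - f a t)) =
    (fun h : R => h^-1 *: (fpair (h *: (0, 1) + (a, t)) - fpair (a, t))).
  apply/funext => h; congr (_ *: (_ - _)); rewrite /fpair/=.
  by rewrite scaler0 add0r.
by rewrite E.
Qed.

Lemma continuous_potential_phi (a t : R) : 0 < t ->
  {for (a, t), continuous (fun z : R * R => dpotential f z.1 z.2)}.
Proof.
move=> t0; have [/(_ 1%N)[_ /(_ (1, 0))[_ [C _]]] _ _] := hf.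
have := C (a, t) t0.
by have -> // : (fun z : R * R => dpotential f z.1 z.2) = (fun x => 'D_(1, 0) fpair x)
  by apply/funext => -[].
Qed.

Lemma derivable_helmholtz (a : R) (b : 'rV[R]_d) (t : R) :
  0 < t -> derivable (helmholtz f kappa a b) t 1.
Proof.
move=> t0; have [_ /(_ t t0) dk _] := hk.
have -> : helmholtz f kappa a b = f a + (dot b b / 2) *: kappa.
  by apply/funext => s; rewrite /helmholtz [RHS](_ : _ = f a s + dot b b / 2 * kappa s)//; ring.
by apply: derivableD; [exact: derivable_potential|exact: derivableZ].
Qed.

Section line.
Variables (a al c ga : R) (b be : 'rV[R]_d).

Let A (l : R) := a + l * al.
Let B (l : R) := b + l *: be.
Let C (l : R) := c + l * ga.
(** The function of [t] whose critical points are the temperatures of the state at [l]; its value at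
    [Th l] is the internal energy. *)
Let G (l t : R) := helmholtz f kappa (A l) (B l) t + t * C l.
Let Th (l : R) := temperature f kappa (A l) (B l) (C l).

(** The strict inequality comes from [f]; the term with [kappa] is concave because its factor, half
    the square of [B l], is non-negative, and [t * C l] is linear. *)
Let strictly_concave_G (l : R) : strictly_concave_on_pos (G l).
Proof.
move=> x y r x0 y0 xy r01.
have [_ /(_ (A l) x y r x0 y0 xy r01) cf _] := hf.
have [_ _ ck] := hk.
have r01' : 0 <= r <= 1 by move/andP: r01 => [/ltW -> /ltW ->].
have := ck x y r x0 y0 r01' => {}ck.
have : r * (kappa x * dot (B l) (B l)) + (1 - r) * (kappa y * dot (B l) (B l))
    <= kappa (r * x + (1 - r) * y) * dot (B l) (B l).
  by rewrite !mulrA -mulrDl ler_wpM2r// dot_ge0.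
by move: cf; rewrite /G /helmholtz; lra.
Qed.

Let is_derive_affine (p q l : R) : is_derive l 1 (fun l => p + l * q) q.
Proof.
apply/is_derive1P => e e0; near=> h.
have -> : p + (l + h) * q - (p + l * q) - q * h = 0 by ring.
by rewrite normr0 mulr_ge0// ltW.
Unshelve. all: by end_near. Qed.

Let is_derive_G_t (l t : R) : 0 < t ->
  is_derive t 1 (G l) (C l - entropy f kappa (A l) (B l) t).
Proof.
move=> t0; have dh :=
  derivableP (derivable_helmholtz t0 : derivable (helmholtz f kappa (A l) (B l)) t 1).
have da := is_derive_affine 0 (C l) t.
have -> : G l = helmholtz f kappa (A l) (B l) + (fun t => 0 + t * C l).
  apply/funext => s; rewrite /G.
  by rewrite [RHS](_ : _ = helmholtz f kappa (A l) (B l) s + (0 + s * C l))// add0r.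
by apply: (is_derive_eq (is_deriveD dh da)); rewrite /entropy derive1E; ring.
Qed.

Let dG (l t : R) := dpotential f (A l) t * al + kappa t * dot (B l) be + t * ga.

Let is_derive_G_l (l t : R) : 0 < t -> is_derive l 1 (G ^~ t) (dG l t).
Proof.
move=> t0.
have d1 := is_derive1_comp (is_derive_potential_phi (A l) t0) (is_derive_affine a al l).
have d2 := is_derive_affine (t * c + kappa t / 2 * dot b b) (t * ga + kappa t * dot b be) l.
(* Expanding the square of [b + l *: be] splits the dependence on [l] into a composite with [f], an
   affine part and a multiple of the square of [l]. *)
have -> : G ^~ t = ((f ^~ t) \o A) + (fun l => (t * c + kappa t / 2 * dot b b) +
     l * (t * ga + kappa t * dot b be)) + (kappa t / 2 * dot be be) *: (id * id).
  apply/funext => s; rewrite /G /helmholtz /B /C.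
  rewrite [RHS](_ : _ = f (A s) t + ((t * c + kappa t / 2 * dot b b) +
    s * (t * ga + kappa t * dot b be)) + (kappa t / 2 * dot be be) * (s * s))//.
  by rewrite !(dotDl, dotDr, dotZl, dotZr) (dotC be b); field.
have d3 := is_deriveM (is_derive_id l 1) (is_derive_id l (1 : R)).
apply: (is_derive_eq (is_deriveD (is_deriveD d1 d2) (is_deriveZ (kappa t / 2 * dot be be) d3))).
by rewrite /dG /B dotDl dotZl /GRing.scale/=; field.
Qed.

(** The derivative of [G l] at [t] is [C l] minus the entropy at [t], so it vanishes exactly at the
    temperatures. *)
Let ex_critical (l : R) : energy_domain f kappa (A l) (B l) (C l) <->
  exists2 t : R, 0 < t & is_derive t 1 (G l) 0.
Proof.
split=> [[t [t0 cE]]|[t t0 dt]].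
  by exists t => //; apply: is_derive_eq; [exact: is_derive_G_t|rewrite cE subrr].
exists t; split=> //; have [_ dE] := is_derive_G_t l t0; have [_ dt0] := dt.
by apply/eqP; rewrite -subr_eq0 -dE dt0.
Qed.

(** Once the set of temperatures is inhabited, [xget] returns one of its elements rather than the
    dummy value 1. *)
Let temperature_critical (l : R) : (exists2 t : R, 0 < t & is_derive t 1 (G l) 0) ->
  0 < Th l /\ is_derive (Th l) 1 (G l) 0.
Proof.
move=> /ex_critical D.
have [T0 TE] : temperatures f kappa (A l) (B l) (C l) (Th l).
  exact: (xgetPex 1 D).
by split=> //; apply: is_derive_eq; [exact: is_derive_G_t|rewrite TE subrr].
Qed.

(** The domain is assumed at [l] only: [maximizer_continuous] shows that nearby states again have a
    temperature and that it varies continuously, which is what the envelope theorem asks for. *)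
Lemma internal_energy_line (l : R) :
  energy_domain f kappa (A l) (B l) (C l) ->
  [/\ 0 < Th l, {for l, continuous Th} &
    is_derive l 1 (fun l => internal_energy f kappa (A l) (B l) (C l))
      (dpotential f (A l) (Th l) * al + kappa (Th l) * dot (B l) be + Th l * ga)].
Proof.
move=> /ex_critical D; have [T0 _] := temperature_critical D.
have [cT mT] : {for l, continuous Th} /\
    \forall h \near l, 0 < Th h /\ forall t : R, 0 < t -> G h t <= G h (Th h).
  apply: maximizer_continuous => //.
  - by move=> h t t0; have [] := is_derive_G_t h t0.
  - move=> t t0; apply/differentiable_continuous/derivable1_diffP.
    by have [] := is_derive_G_l l t0.
split=> //.
(* By conversion the internal energy at [l] is [G l (Th l)]. What remains is the joint continuity of
   [dG] at [(l, Th l)]. *)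
apply: (envelope_is_derive is_derive_G_l) => //.
have cA : {for (l, Th l), continuous (fun z : R * R => A z.1)}.
  by apply: cvgD; [exact: cvg_cst|apply: cvgM; [exact: cvg_fst|exact: cvg_cst]].
have ck : {for (l, Th l), continuous (fun z : R * R => kappa z.2)}.
  apply: continuous_comp; first exact: cvg_snd.
  by apply/differentiable_continuous/derivable1_diffP; have [_ + _] := hk; exact.
have cd : {for (l, Th l), continuous (fun z : R * R => dpotential f (A z.1) z.2)}.
  apply: (@continuous2_cvg _ _ _ _ _ _ (fun z : R * R => A z.1) snd (dpotential f)) => //.
    exact: continuous_potential_phi.
  exact: cvg_snd.
have -> : (fun z : R * R => dG z.1 z.2) = (fun z => dpotential f (A z.1) z.2 * al +
    kappa z.2 * (dot b be + z.1 * dot be be) + z.2 * ga).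
  by apply/funext => z; rewrite /dG /B dotDl dotZl.
apply: cvgD; first apply: cvgD.
- by apply: cvgM; [exact: cd|exact: cvg_cst].
- apply: cvgM; first exact: ck.
  by apply: cvgD; [exact: cvg_cst|apply: cvgM; [exact: cvg_fst|exact: cvg_cst]].
- by apply: cvgM; [exact: cvg_snd|exact: cvg_cst].
Qed.

End line.
End energy.

(** * Real-valued integrals of linear combinations *)

Lemma integrable_EFinZ (dsp : measure_display) (T : measurableType dsp) (R : realType)
    (mu : {measure set T -> \bar R}) (D : set T) (k : R) (g : T -> R) :
  measurable D -> mu.-integrable D (EFin \o g) ->
  mu.-integrable D (EFin \o (fun x => k * g x)).
Proof.
move=> mD ig; rewrite (_ : EFin \o _ = (fun x => k%:E * (EFin \o g) x)%E).
  exact: integrableZl.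
by apply/funext => x; rewrite /= EFinM.
Qed.

Lemma integrable_EFinD (dsp : measure_display) (T : measurableType dsp) (R : realType)
    (mu : {measure set T -> \bar R}) (D : set T) (g h : T -> R) :
  measurable D -> mu.-integrable D (EFin \o g) -> mu.-integrable D (EFin \o h) ->
  mu.-integrable D (EFin \o (fun x => g x + h x)).
Proof.
move=> mD ig ih; rewrite (_ : EFin \o _ = (EFin \o g) \+ (EFin \o h))%E.
  exact: integrableD.
by apply/funext => x; rewrite /= EFinD.
Qed.

Lemma integrable_sumR (dsp : measure_display) (T : measurableType dsp) (R : realType)
    (mu : {measure set T -> \bar R}) (D : set T) (J : Type) (s : seq J) (F : J -> T -> R) :
  measurable D -> (forall j, mu.-integrable D (EFin \o F j)) ->
  mu.-integrable D (EFin \o (fun x => \sum_(j <- s) F j x)).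
Proof.
move=> mD iF.
have -> : EFin \o (fun x => \sum_(j <- s) F j x) = (fun x => \sum_(j <- s) (F j x)%:E)%E.
  by apply/funext => x; rewrite /= sumEFin.
exact: (@integrable_sum _ _ _ mu D mD J s xpredT _ (fun j _ => iF j)).
Qed.

Lemma Rintegral_sum (dsp : measure_display) (T : measurableType dsp) (R : realType)
    (mu : {measure set T -> \bar R}) (D : set T) (J : Type) (s : seq J) (F : J -> T -> R) :
  measurable D -> (forall j, mu.-integrable D (EFin \o F j)) ->
  \int[mu]_(x in D) (\sum_(j <- s) F j x) = \sum_(j <- s) \int[mu]_(x in D) F j x.
Proof.
move=> mD iF; elim: s => [|j s IH].
  by rewrite big_nil; under eq_Rintegral do rewrite big_nil; rewrite Rintegral_cst// mul0r.
rewrite big_cons -IH -RintegralD//; last exact: integrable_sumR.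
by apply: eq_Rintegral => x _; rewrite big_cons.
Qed.

(** Turns each partial derivative of [e] into a derivative at 0 along a line, the form computed by
    [internal_energy_line]. *)
Lemma derive_line (R : realType) (V : normedModType R) (F : V -> R) (x v : V) :
  'D_v F x = 'D_1 (fun h : R => F (x + h *: v)) 0.
Proof.
rewrite /derive; set g1 := fun h => h^-1 *: _; set g2 := fun h => h^-1 *: _.
suff -> : g1 = g2 by []; apply/funext => h; rewrite /g1 /g2/=.
by rewrite addr0 scale0r addr0 [h *: (1 : R)]mulr1 [x + _]addrC.
Qed.

(** * Partial derivatives of the internal energy and its increment along a segment *)

Section energy_derivatives.
Context (R : realType) (d : nat).
Variables (f : R -> R -> R) (kappa : R -> R).
Hypotheses (hf : admissible_potential f) (hk : admissible_kappa kappa).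

(** A general direction [(al, be, ga)] is treated once; the partial derivatives below are the
    coordinate directions. *)
Lemma derive_internal_energy (a al c ga : R) (b be : 'rV[R]_d) :
  energy_domain f kappa a b c ->
  'D_1 (fun h : R => internal_energy f kappa (a + h * al) (b + h *: be) (c + h * ga)) 0 =
    let t := temperature f kappa a b c in
    dpotential f a t * al + kappa t * dot b be + t * ga.
Proof.
move=> D; have := @internal_energy_line R d f kappa hf hk a al c ga b be 0.
rewrite !mul0r scale0r !addr0 => /(_ D)[_ _ [_ ->]].
by [].
Qed.

Lemma denergy_phiE (a c : R) (b : 'rV[R]_d) : energy_domain f kappa a b c ->
  denergy_phi f kappa a b c = dpotential f a (temperature f kappa a b c).
Proof.
move=> D; rewrite /denergy_phi derive1E derive_line.
have := @derive_internal_energy a 1 c 0 b 0 D.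
rewrite /= dot0r !mulr0 mulr1 !addr0 => <-.
by apply: (congr1 (fun F : R -> R => 'D_1 F 0)); apply/funext => h; rewrite !mulr0 scaler0 !addr0.
Qed.

Lemma denergy_sE (a c : R) (b : 'rV[R]_d) : energy_domain f kappa a b c ->
  denergy_s f kappa a b c = temperature f kappa a b c.
Proof.
move=> D; rewrite /denergy_s derive1E derive_line.
have := @derive_internal_energy a 0 c 1 b 0 D.
rewrite /= dot0r !mulr0 mulr1 !add0r => <-.
by apply: (congr1 (fun F : R -> R => 'D_1 F 0)); apply/funext => h; rewrite !mulr0 scaler0 !addr0.
Qed.

Lemma denergy_gradE (a c : R) (b : 'rV[R]_d) : energy_domain f kappa a b c ->
  denergy_grad f kappa a b c = kappa (temperature f kappa a b c) *: b.
Proof.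
move=> D; apply/rowP => j; rewrite !mxE derive_line.
have := @derive_internal_energy a 0 c 0 b (delta_mx 0 j) D.
rewrite /= dot_delta !mulr0 addr0 add0r => <-.
by apply: (congr1 (fun F : R -> R => 'D_1 F 0)); apply/funext => h; rewrite !mulr0 !addr0.
Qed.

(** The fundamental theorem of calculus along the segment. The three integrals combine into the
    integral of one function, the derivative of [E]. *)
Lemma internal_energy_increment (a al c ga : R) (b be : 'rV[R]_d) (x y : R) :
  let A l := a + l * al in let B l := b + l *: be in let C l := c + l * ga in
  x < y -> (forall l, l \in `[x, y] -> energy_domain f kappa (A l) (B l) (C l)) ->
  internal_energy f kappa (A y) (B y) (C y) - internal_energy f kappa (A x) (B x) (C x) =
    al * \int[lebesgue_measure]_(l in `[x, y]) denergy_phi f kappa (A l) (B l) (C l) +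
    dot (\row_i \int[lebesgue_measure]_(l in `[x, y])
           denergy_grad f kappa (A l) (B l) (C l) 0 i) be +
    ga * \int[lebesgue_measure]_(l in `[x, y]) denergy_s f kappa (A l) (B l) (C l).
Proof.
move=> A B C xy D.
pose Th (l : R) := temperature f kappa (A l) (B l) (C l).
pose P (l : R) := dpotential f (A l) (Th l).
pose Q i (l : R) := kappa (Th l) * B l 0 i.
pose E (l : R) := internal_energy f kappa (A l) (B l) (C l).
have line l : l \in `[x, y] -> [/\ 0 < Th l, {for l, continuous Th} &
    is_derive l 1 E (P l * al + kappa (Th l) * dot (B l) be + Th l * ga)].
  by move=> lxy; apply: internal_energy_line => //; exact: D.
have within g : (forall l, l \in `[x, y] -> {for l, continuous g}) ->
    {within `[x, y], continuous (g : R -> R)}.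
  by move=> cg; apply: continuous_in_subspaceT => l; rewrite inE => /cg.
have int g : {within `[x, y], continuous (g : R -> R)} ->
    lebesgue_measure.-integrable `[x, y] (EFin \o g).
  by apply: continuous_compact_integrable; exact: segment_compact.
have cTh l : l \in `[x, y] -> {for l, continuous Th} by case/line.
have cP : {within `[x, y], continuous P}.
  apply: within => l lxy; have [T0 cT _] := line l lxy.
  apply: (@continuous2_cvg _ _ _ _ _ _ A Th (dpotential f)) => //.
    exact: continuous_potential_phi.
  by apply: cvgD; [exact: cvg_cst|apply: cvgM; [exact: cvg_id|exact: cvg_cst]].
have cQ i : {within `[x, y], continuous (Q i)}.
  apply: within => l lxy; have [T0 cT _] := line l lxy.
  apply: cvgM.
    apply: (@continuous_comp _ _ _ Th kappa) => //.
    by apply/differentiable_continuous/derivable1_diffP; have [_ + _] := hk; exact.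
  rewrite (_ : (fun z => B z 0 i) = (fun z => b 0 i + z * be 0 i)); last first.
    by apply/funext => z; rewrite !mxE.
  rewrite (_ : B l 0 i = b 0 i + l * be 0 i); last by rewrite !mxE.
  by apply: cvgD; [exact: cvg_cst|apply: cvgM; [exact: cvg_id|exact: cvg_cst]].
have mxy : measurable `[x, y] by exact: measurable_itv.
(* On the domain the partial derivatives are replaced by their expressions in the temperature, which
   are continuous along the segment and hence integrable. *)
have -> : \int[lebesgue_measure]_(l in `[x, y]) denergy_phi f kappa (A l) (B l) (C l) =
    \int[lebesgue_measure]_(l in `[x, y]) P l.
  by apply: eq_Rintegral => l; rewrite inE => lxy; apply: denergy_phiE; exact: D.
have -> : \int[lebesgue_measure]_(l in `[x, y]) denergy_s f kappa (A l) (B l) (C l) =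
    \int[lebesgue_measure]_(l in `[x, y]) Th l.
  by apply: eq_Rintegral => l; rewrite inE => lxy; apply: denergy_sE; exact: D.
have -> : \row_i \int[lebesgue_measure]_(l in `[x, y]) denergy_grad f kappa (A l) (B l) (C l) 0 i =
    \row_i \int[lebesgue_measure]_(l in `[x, y]) Q i l.
  apply/rowP => i; rewrite !mxE; apply: eq_Rintegral => l; rewrite inE => lxy.
  by rewrite (denergy_gradE (D l lxy)) mxE.
(* The pairing of the gradient part with [be], written as a finite sum so that it passes through the
   integral. *)
pose S (l : R) := \sum_(i < d) be 0 i * Q i l.
have iQ i : lebesgue_measure.-integrable `[x, y] (EFin \o Q i) by exact: int.
have iZ k g : lebesgue_measure.-integrable `[x, y] (EFin \o g) ->
    lebesgue_measure.-integrable `[x, y] (EFin \o (fun l => k * g l : R)).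
  exact: integrable_EFinZ.
have iS : lebesgue_measure.-integrable `[x, y] (EFin \o S).
  by apply: integrable_sumR => // i; exact: iZ.
have iP := int _ cP; have iT := int _ (within _ cTh).
have -> : dot (\row_i \int[lebesgue_measure]_(l in `[x, y]) Q i l) be =
    \int[lebesgue_measure]_(l in `[x, y]) S l.
  rewrite /S Rintegral_sum//; last by move=> i; exact: iZ.
  rewrite /dot big_ord1; apply: eq_bigr => i _.
  by rewrite mxE RintegralZl// mulrC.
have iaP : lebesgue_measure.-integrable `[x, y] (EFin \o (fun l => al * P l)) by exact: iZ.
have igT : lebesgue_measure.-integrable `[x, y] (EFin \o (fun l => ga * Th l)) by exact: iZ.
rewrite -!RintegralZl// -RintegralD// -RintegralD//; last exact: integrable_EFinD.
have dE l : l \in `[x, y] -> is_derive l 1 E (al * P l + S l + ga * Th l).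
  move=> /line[_ _]; rewrite [_ * al]mulrC [_ * ga]mulrC.
  suff -> : kappa (Th l) * dot (B l) be = S l by [].
  rewrite /dot big_ord1 mulr_sumr; apply: eq_bigr => i _.
  by rewrite /Q mulrA mulrC.
(* The derivative exists at [x] and [y] too, since the line continues beyond the segment; this gives
   the one-sided continuity needed at the end points. *)
have cE l : l \in `[x, y] -> {for l, continuous E}.
  by move=> /dE[dEl _]; apply/differentiable_continuous/derivable1_diffP.
have xin : x \in `[x, y] by rewrite in_itv/= lexx ltW.
have yin : y \in `[x, y] by rewrite in_itv/= lexx ltW.
have sub l : l \in `]x, y[ -> l \in `[x, y].
  by rewrite !in_itv/= => /andP[/ltW -> /ltW ->].
rewrite /Rintegral (@continuous_FTC2 _ _ E x y)//.
- have cS : {within `[x, y], continuous S}.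
    rewrite /S; elim: (index_enum _) => [|i r IH].
      rewrite (_ : (fun _ => _) = cst 0); last by apply/funext => l; rewrite big_nil.
      by move=> l; exact: cvg_cst.
    rewrite (_ : (fun _ => _) = (fun l => be 0 i * Q i l + \sum_(j <- r) be 0 j * Q j l)).
      by move=> l; apply: cvgD; [apply: cvgM; [exact: cvg_cst|exact: cQ]|exact: IH].
    by apply/funext => l; rewrite big_cons.
  move=> l; apply: cvgD; first apply: cvgD.
  + by apply: cvgM; [exact: cvg_cst|exact: cP].
  + exact: cS.
  + by apply: cvgM; [exact: cvg_cst|exact: (within _ cTh)].
- split.
  + by move=> l /sub/dE[].
  + exact/cvg_at_right_filter/cE.
  + exact/cvg_at_left_filter/cE.
- by move=> l /sub/dE[_]; rewrite derive1E.
Qed.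

End energy_derivatives.

(** * Finite element spaces *)

Section measure.
Context (R : realType).

Lemma open_measurable_mx (m n : nat) (A : set 'M[R]_(m, n)) : open A -> measurable A.
Proof. exact: sub_sigma_algebra. Qed.

Lemma continuous_measurable_mx (m n : nat) (g : 'M[R]_(m, n) -> R) :
  continuous g -> measurable_fun setT g.
Proof.
move=> cg; apply: (measurability _ (RGenOpens.measurableE R)) => _ [_ [a [b ->]] <-].
rewrite setTI; apply: sub_sigma_algebra; apply: open_comp; last exact: interval_open.
by move=> x _; exact: cg.
Qed.

Lemma measurable_Omega (d : nat) (L : 'rV[R]_d) : measurable (Omega L).
Proof.
rewrite [X in measurable X](_ : _ = \bigcap_(i in [set: 'I_d])
    ((fun x : 'rV[R]_d => x 0 i) @^-1` `[0, L 0 i])).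
  apply: fin_bigcap_measurable => // i _.
  by rewrite -[X in measurable X]setTI; apply: measurable_coord.
by apply/seteqP; split=> [x Ox i _|x Ox i]; have := Ox i; rewrite /= in_itv/=; apply.
Qed.

(** Induction on the dimension: through [rVcons] the box is the product of an interval and a box of
    one dimension less, and in dimension 0 the measure is a Dirac mass. *)
Lemma lebesgue_rV_Omega_lty (d : nat) (L : 'rV[R]_d) :
  (lebesgue_rV R d (Omega L) < +oo)%E.
Proof.
elim: d L => [|d IH] L.
  apply: le_lt_trans (ltry 1); rewrite /= diracE.
  by case: (_ \in _); rewrite lee_fin.
pose L' : 'rV[R]_d := \row_j L 0 (lift 0 j).
have E : @rVcons R d @^-1` Omega L = `[0, L 0 0] `*` Omega L'.
  have c0 (x : R * 'rV[R]_d) : rVcons x 0 0 = x.1.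
    by rewrite mxE; case: fintype.splitP => // k; rewrite mxE.
  have cj (x : R * 'rV[R]_d) j : rVcons x 0 (lift 0 j) = x.2 0 j.
    rewrite mxE; case: fintype.splitP => [[[]//]|k /=].
    by rewrite add1n => -[] /val_inj ->.
  apply/seteqP; split=> [x Ox|x [/= x1 x2] i].
    split=> /=; first by have := Ox 0; rewrite c0 in_itv.
    by move=> j; have := Ox (lift 0 j); rewrite cj mxE.
  have [j ->|->] := unliftP 0 i; first by rewrite cj; have := x2 j; rewrite mxE.
  by rewrite c0; rewrite in_itv in x1.
change ((lebesgue_measure \x lebesgue_rV R d)%E (@rVcons R d @^-1` Omega L) < +oo)%E.
rewrite E product_measure1E//; last exact: measurable_Omega.
apply: lte_mul_pinfty; [by []| |exact: IH].
rewrite ge0_fin_numE//.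
suff H (r : R) : (lebesgue_measure (`[(0%R : R), r]%classic : set R) < +oo)%E by exact: H.
rewrite lebesgue_measure_itv/=.
by case: ifP => // _; rewrite ?ltry// -EFinB ltry.
Qed.

End measure.

(** The closure properties are stated for [r * g + q * h], the common shape of [dtau], [mid] and
    [interp]. *)
Lemma continuous_comb (R : realType) (T : topologicalType) (r q : R) (g h : T -> R) (x : T) :
  {for x, continuous g} -> {for x, continuous h} ->
  {for x, continuous (fun y => r * g y + q * h y)}.
Proof.
by move=> cg ch; apply: cvgD; apply: cvgM; solve [exact: cvg_cst|exact: cg|exact: ch].
Qed.

Lemma is_derive_comb (R : realType) (V : normedModType R) (r q : R) (g h : V -> R) (x v : V) :
  derivable g x v -> derivable h x v ->
  is_derive x v (fun y => r * g y + q * h y) (r * 'D_v g x + q * 'D_v h x).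
Proof.
move=> /derivableP dg /derivableP dh.
exact: (is_deriveD (is_deriveZ r dg) (is_deriveZ q dh)).
Qed.

(** * Stability of [L2], smoothness and [H1] under linear combinations *)

Section spaces.
Context (R : realType) (d : nat) (L : 'rV[R]_d).
Implicit Types g h : 'rV[R]_d -> R.
Let mu := lebesgue_rV R d.

(** Pointwise, the right side exceeds the left by the square of [r * g x - q * h x]. *)
Lemma integral_sqr_comb (r q : R) g h :
  measurable_fun (Omega L) g -> measurable_fun (Omega L) h ->
  (\int[mu]_(x in Omega L) ((r * g x + q * h x) ^+ 2)%:E <=
   (2 * r ^+ 2)%:E * \int[mu]_(x in Omega L) ((g x) ^+ 2)%:E +
   (2 * q ^+ 2)%:E * \int[mu]_(x in Omega L) ((h x) ^+ 2)%:E)%E.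
Proof.
move=> mg mh; have mO := measurable_Omega L.
have m2 (k : 'rV[R]_d -> R) : measurable_fun (Omega L) k ->
    measurable_fun (Omega L) (fun x => ((k x) ^+ 2)%:E).
  by move=> mk; apply/measurable_EFinP; exact: measurable_funX.
have mZ (p : R) (k : 'rV[R]_d -> R) : measurable_fun (Omega L) k ->
    measurable_fun (Omega L) (fun x => p * k x).
  by move=> mk; apply: measurable_funM.
have sq0 (p : R) : 0 <= p ^+ 2 by exact: sqr_ge0.
have c0 (p : R) : 0 <= 2 * p ^+ 2 by rewrite mulr_ge0.
have Z (p : R) (k : 'rV[R]_d -> R) : measurable_fun (Omega L) k ->
    ((2 * p ^+ 2)%:E * \int[mu]_(x in Omega L) ((k x) ^+ 2)%:E =
     \int[mu]_(x in Omega L) ((2 * p ^+ 2)%:E * ((k x) ^+ 2)%:E))%E.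
  move=> mk; rewrite ge0_integralZl_EFin//; last exact: m2.
  by move=> x _; rewrite lee_fin.
rewrite Z// Z// -ge0_integralD//; first last.
- by apply: measurable_funeM; exact: m2.
- by move=> x _; rewrite -EFinM lee_fin mulr_ge0.
- by apply: measurable_funeM; exact: m2.
- by move=> x _; rewrite -EFinM lee_fin mulr_ge0.
apply: ge0_le_integral => //.
- by move=> x _; rewrite lee_fin sqr_ge0.
- by apply: m2; apply: measurable_funD; exact: mZ.
- by apply: emeasurable_funD; apply: measurable_funeM; exact: m2.
- move=> x _; rewrite -!EFinM -EFinD lee_fin -subr_ge0.
  have -> : 2 * r ^+ 2 * g x ^+ 2 + 2 * q ^+ 2 * h x ^+ 2 - (r * g x + q * h x) ^+ 2 =
     (r * g x - q * h x) ^+ 2 by ring.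
  exact: sqr_ge0.
Qed.

Lemma L2_comb (r q : R) g h : L2 L g -> L2 L h -> L2 L (fun x => r * g x + q * h x).
Proof.
move=> [mg ig] [mh ih]; split.
  by apply: measurable_funD; apply: measurable_funM.
apply: le_lt_trans (integral_sqr_comb _ _ mg mh) _.
by apply: lte_add_pinfty; (apply: lte_mul_pinfty; [by rewrite lee_fin mulr_ge0// sqr_ge0| |]).
Qed.

Lemma Ck_on_comb (k : nat) (r q : R) g h : Ck_on setT k g -> Ck_on setT k h ->
  Ck_on setT k (fun x => r * g x + q * h x).
Proof.
elim: k g h => [|k IH] g h [cg dg] [ch dh].
  split=> // x _; by apply: continuous_comb; [exact: cg|exact: ch].
split=> [x _|v].
  by apply: continuous_comb; [exact: cg|exact: ch].
have [dgv Cg] := dg v; have [dhv Ch] := dh v.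
split=> [x _|]; first by have [] := is_derive_comb r q (dgv x Logic.I) (dhv x Logic.I).
rewrite (_ : (fun x => _) = (fun x => r * 'D_v g x + q * 'D_v h x)); first exact: IH.
by apply/funext => x; have [] := is_derive_comb r q (dgv x Logic.I) (dhv x Logic.I).
Qed.

Lemma measurable_smooth g : smooth_on setT g -> measurable_fun (Omega L) g.
Proof.
move=> /(_ 0%N)[cg _]; apply: (@measurable_funS _ _ _ _ setT) => //.
by apply: continuous_measurable_mx => x; exact: cg.
Qed.

Lemma grad_comb (r q : R) g h x : (forall v, derivable g x v) -> (forall v, derivable h x v) ->
  grad (fun y => r * g y + q * h y) x = r *: grad g x + q *: grad h x.
Proof.
move=> dg dh; apply/rowP => j; rewrite !mxE.
by have [] := is_derive_comb r q (dg (delta_mx 0 j)) (dh (delta_mx 0 j)).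
Qed.

Lemma measurable_grad_smooth g i : smooth_on setT g ->
  measurable_fun (Omega L) (fun x => grad g x 0 i).
Proof.
move=> /(_ 1%N)[_ /(_ (delta_mx 0 i))[_ [c _]]].
apply: (@measurable_funS _ _ _ _ setT) => //; apply: continuous_measurable_mx => x.
rewrite (_ : (fun x => grad g x 0 i) = 'D_(delta_mx 0 i) g); first exact: c.
by apply/funext => y; rewrite mxE.
Qed.

Lemma H1_comb (r q : R) g h : H1 L g -> H1 L h -> H1 L (fun x => r * g x + q * h x).
Proof.
move=> [Lg [Gg LGg ag]] [Lh [Gh LGh ah]]; split; first exact: L2_comb.
exists (fun x => r *: Gg x + q *: Gh x).
  move=> i; rewrite (_ : (fun x => _) = (fun x => r * Gg x 0 i + q * Gh x 0 i)).
    exact: L2_comb.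
  by apply/funext => x; rewrite !mxE.
(* When both approximation errors are below [e / K], [integral_sqr_comb] bounds the combined one by
   [(K - 1) * (e / K) < e]. The summand 1 keeps [K] positive for [r = q = 0]. *)
move=> e e0; pose K := 2 * r ^+ 2 + 2 * q ^+ 2 + 1.
have K0 : 0 < K by rewrite ltr_wpDl// addr_ge0// mulr_ge0// sqr_ge0.
have eK : 0 < e / K by rewrite divr_gt0.
have [wg [sg pg lg gg]] := ag _ eK; have [wh [sh ph lh gh]] := ah _ eK.
have bound (a b : 'rV[R]_d -> R) : measurable_fun (Omega L) a -> measurable_fun (Omega L) b ->
    (\int[mu]_(x in Omega L) ((a x) ^+ 2)%:E < (e / K)%:E)%E ->
    (\int[mu]_(x in Omega L) ((b x) ^+ 2)%:E < (e / K)%:E)%E ->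
    (\int[mu]_(x in Omega L) ((r * a x + q * b x) ^+ 2)%:E < e%:E)%E.
  move=> ma mb la lb; apply: le_lt_trans (integral_sqr_comb _ _ ma mb) _.
  apply: (@le_lt_trans _ _ ((2 * r ^+ 2)%:E * (e / K)%:E + (2 * q ^+ 2)%:E * (e / K)%:E)%E).
    by apply: leeD; (apply: lee_wpmul2l; [by rewrite lee_fin mulr_ge0// sqr_ge0|exact: ltW]).
  rewrite -!EFinM -EFinD lte_fin -mulrDl mulrCA gtr_pMr// ltr_pdivrMr// mul1r.
  by rewrite /K ltrDl.
exists (fun x => r * wg x + q * wh x); split.
- by move=> k; exact: Ck_on_comb.
- by move=> x i; rewrite pg ph.
- rewrite (_ : (fun x => _) = (fun x => ((r * (g x - wg x) + q * (h x - wh x)) ^+ 2)%:E)).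
    apply: bound => //; apply: measurable_funB.
    + by have [] := Lg.
    + exact: measurable_smooth.
    + by have [] := Lh.
    + exact: measurable_smooth.
  by apply/funext => x; congr EFin; ring.
- move=> i; rewrite (_ : (fun x => _) =
    (fun x => ((r * (Gg x 0 i - grad wg x 0 i) + q * (Gh x 0 i - grad wh x 0 i)) ^+ 2)%:E)).
    apply: bound => //; apply: measurable_funB.
    + by have [] := LGg i.
    + exact: measurable_grad_smooth.
    + by have [] := LGh i.
    + exact: measurable_grad_smooth.
  apply/funext => x; rewrite grad_comb ?mxE.
  + by congr EFin; ring.
  + by move=> v; have [_ /(_ v)[+ _]] := sg 1%N; exact.
  + by move=> v; have [_ /(_ v)[+ _]] := sh 1%N; exact.
Qed.

End spaces.

(** * Finite element functions on a conforming mesh *)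

Section finite_elements.
Context (R : realType) (d : nat) (I : finType).
Variables (L : 'rV[R]_d) (mesh : I -> 'I_d.+1 -> 'rV[R]_d).
Hypothesis hmesh : periodic_conforming_mesh L mesh.

Lemma open_elements : open (elements mesh).
Proof. by apply: bigcup_open => i _; exact: open_interior. Qed.

Lemma measurable_elements : measurable (elements mesh).
Proof. by apply: open_measurable_mx; exact: open_elements. Qed.

Lemma elements_Omega : elements mesh `<=` Omega L.
Proof.
by have [_ _ <- _] := hmesh => x [i _ /interior_subset ix]; exists i.
Qed.

Lemma lagrange_comb (k : nat) (r q : R) (g h : 'rV[R]_d -> R) :
  Defs.lagrange L mesh k g -> Defs.lagrange L mesh k h ->
  Defs.lagrange L mesh k (fun x => r * g x + q * h x).
Proof.
move=> [pg Hg cg lg] [ph Hh ch lh]; split.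
- by move=> x i; rewrite pg ph.
- exact: H1_comb.
- by move=> x; apply: continuous_comb; [exact: cg|exact: ch].
- move=> i; have [a ga] := lg i; have [b hb] := lh i.
  exists (fun al => r * a al + q * b al) => x ix.
  rewrite (ga x ix) (hb x ix) !mulr_sumr -big_split/=.
  by apply: eq_bigr => al _; rewrite mulrDl !mulrA.
Qed.

Lemma Xh_comb (r q : R) (v w : 'rV[R]_d -> 'rV[R]_d) :
  Xh L mesh v -> Xh L mesh w -> Xh L mesh (fun x => r *: v x + q *: w x).
Proof.
move=> Xv Xw i; rewrite (_ : (fun x => _) = (fun x => r * v x 0 i + q * w x 0 i)).
  exact: lagrange_comb.
by apply/funext => x; rewrite !mxE.
Qed.

(** The constant 1 is the test function for the mass and entropy balances; it is square integrable
    because [Omega] has finite volume. *)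
Lemma Vh_cst1 : Vh L mesh (cst 1).
Proof.
have L2c (r : R) : L2 L (cst r).
  split; first exact: measurable_cst.
  rewrite [X in (X < _)%E](integral_cst (lebesgue_rV R d) (measurable_Omega L) (r ^+ 2)%:E).
  by rewrite lte_mul_pinfty ?lee_fin ?sqr_ge0//; exact: lebesgue_rV_Omega_lty.
(* All constants are treated together, since differentiating [cst r] leads to [cst 0]. *)
have sm k : forall r : R, Ck_on (setT : set 'rV[R]_d) k (cst r).
  elim: k => [|k IH] r; (split; first by move=> x _; exact: cst_continuous) => // v.
  split=> [x _|]; first exact: derivable_cst.
  rewrite (_ : (fun x => _) = cst 0); first exact: IH.
  by apply/funext => x; rewrite derive_cst.
split=> //.
- split; first exact: L2c.
  exists (fun _ => 0).
    by move=> i; rewrite (_ : (fun x => _) = cst 0)//; apply/funext => x; rewrite mxE.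
  move=> e e0; exists (cst 1); split.
  - by move=> k; exact: sm.
  - by [].
  - by under eq_integral do rewrite subrr expr0n; rewrite integral0 lte_fin.
  - move=> i; under eq_integral do rewrite !mxE derive_cst subrr expr0n.
    by rewrite integral0 lte_fin.
- exact: cst_continuous.
(* The only nonzero coefficient belongs to the multi-index 0. *)
- move=> i; exists (fun al => if al == [ffun=> ord0] then 1 else 0) => x _.
  rewrite (bigD1 [ffun=> ord0])/=; last first.
    by rewrite big1// => j _; rewrite ffunE.
  rewrite eqxx mul1r big1 => [|j _]; last by rewrite ffunE expr0.
  by rewrite big1 ?addr0// => al /andP[_ /negbTE ->]; rewrite mul0r.
Qed.

(** Square integrability suffices on a set of finite volume, because the absolute value of [g] is at
    most [1 + g ^+ 2]. *)
Lemma lagrange_integrable (k : nat) (g : 'rV[R]_d -> R) :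
  Defs.lagrange L mesh k g -> integrable_h mesh g.
Proof.
move=> [_ [[mg ig] _] _ _].
apply: (integrableS (measurable_Omega L) measurable_elements elements_Omega).
have mO := measurable_Omega L.
apply: (@le_integrable _ _ _ _ _ mO _ (EFin \o (fun x => 1 + g x ^+ 2))).
- exact/measurable_EFinP.
- move=> x _; rewrite lee_fin [leRHS]ger0_norm ?addr_ge0 ?sqr_ge0//.
  have := sqr_ge0 (g x - 2^-1); have := sqr_ge0 (g x + 2^-1).
  by rewrite /= ler_norml => ? ?; apply/andP; split; lra.
apply: integrable_EFinD => //.
  apply/integrableP; split; first exact/measurable_EFinP.
  rewrite [X in (X < _)%E](integral_cst (lebesgue_rV R d) mO `|1%:E|%E) abse1.
  by rewrite lte_mul_pinfty ?lee_fin//; exact: lebesgue_rV_Omega_lty.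
apply/integrableP; split.
  by apply/measurable_EFinP; exact: measurable_funX.
apply: le_lt_trans ig; rewrite le_eqVlt; apply/orP; left; apply/eqP.
by apply: eq_integral => x _; rewrite /= ger0_norm ?sqr_ge0.
Qed.

Lemma differentiable_bigsum (J : Type) (s : seq J) (P : pred J) (F : J -> 'rV[R]_d -> R) x :
  (forall j, differentiable (F j) x) ->
  differentiable (fun y => \sum_(j <- s | P j) F j y) x.
Proof.
move=> dF; elim: s => [|j s IH].
  rewrite (_ : (fun _ => _) = cst 0); first exact: differentiable_cst.
  by apply/funext => y; rewrite big_nil.
rewrite (_ : (fun _ => _) = (fun y => (if P j then F j y else 0) + \sum_(j <- s | P j) F j y)).
  by apply: differentiableD => //; case: (P j).
by apply/funext => y; rewrite big_cons; case: (P j); rewrite ?add0r.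
Qed.

Lemma differentiable_bigprod (J : Type) (s : seq J) (F : J -> 'rV[R]_d -> R) x :
  (forall j, differentiable (F j) x) ->
  differentiable (fun y => \prod_(j <- s) F j y) x.
Proof.
move=> dF; elim: s => [|j s IH].
  rewrite (_ : (fun _ => _) = cst 1); first exact: differentiable_cst.
  by apply/funext => y; rewrite big_nil.
rewrite (_ : (fun _ => _) = (fun y => F j y * \prod_(j <- s) F j y)).
  exact: differentiableM.
by apply/funext => y; rewrite big_cons.
Qed.

(** A point of [elements mesh] is interior to a simplex, so [g] agrees near it with a polynomial
    defined on the whole space. *)
Lemma lagrange_derivable (k : nat) (g : 'rV[R]_d -> R) x v :
  Defs.lagrange L mesh k g -> elements mesh x -> derivable g x v.
Proof.
move=> [_ _ _ pg] [i _ ix]; have [c gE] := pg i.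
pose P (y : 'rV[R]_d) : R := \sum_(al : {ffun 'I_d -> 'I_k.+1} | (\sum_i al i <= k)%N)
  c al * \prod_i y 0 i ^+ al i.
have nP : \near x, P x = g x by apply: filterS ix => y /gE.
apply: (near_eq_derivable nP).
apply: diff_derivable; apply: differentiable_bigsum => al.
apply: differentiableM => //.
apply: differentiable_bigprod => j.
case: (nat_of_ord (al j)) => [|e]; first by apply: differentiable_cst.
rewrite (_ : (fun y => _) = (fun y : 'rV[R]_d => y 0 j : R) ^+ e.+1); last by rewrite exprfctE.
by apply: differentiableX; exact: differentiable_coord.
Qed.

End finite_elements.

(** * Gradients and integrals *)

Section gradients.
Context (R : realType) (d : nat).
Implicit Types (g h : 'rV[R]_d -> R) (x : 'rV[R]_d).

Lemma grad_cst (r : R) x : grad (fun _ => r) x = 0.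
Proof. by apply/rowP => j; rewrite !mxE derive_cst. Qed.

(** Quotients by the temperature simplify only where it is positive, which is known near points of
    the elements; the gradient depends on nothing else. *)
Lemma near_eq_grad g h x : (\forall y \near x, g y = h y) -> grad g x = grad h x.
Proof. by move=> gh; apply/rowP => j; rewrite !mxE; exact: near_eq_derive. Qed.

Lemma grad_mul g h x : (forall v, derivable g x v) -> (forall v, derivable h x v) ->
  grad (fun y => g y * h y) x = h x *: grad g x + g x *: grad h x.
Proof.
move=> dg dh; apply/rowP => j; rewrite !mxE.
have [_ ->] := is_deriveM (derivableP (dg (delta_mx 0 j))) (derivableP (dh (delta_mx 0 j))).
by rewrite addrC.
Qed.

Lemma grad_dtau (tau : R) (phi : nat -> 'rV[R]_d -> R) n x :
  (forall v, derivable (phi n.+1) x v) -> (forall v, derivable (phi n) x v) ->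
  grad (dtau tau phi n) x = tau^-1 *: (grad (phi n.+1) x - grad (phi n) x).
Proof.
move=> d1 d0; rewrite (_ : dtau tau phi n = (fun y => tau^-1 * phi n.+1 y + (- tau^-1) * phi n y)).
  by rewrite grad_comb// scaleNr scalerBr.
by apply/funext => y; rewrite /dtau /GRing.scale/=; ring.
Qed.

Lemma grad_interp (tau : R) (phi : nat -> 'rV[R]_d -> R) n l x :
  (forall v, derivable (phi n.+1) x v) -> (forall v, derivable (phi n) x v) ->
  grad (interp tau phi n l) x =
    ((l - tgrid tau n) / tau) *: (grad (phi n.+1) x - grad (phi n) x) + grad (phi n) x.
Proof.
move=> d1 d0; pose r := (l - tgrid tau n) / tau.
rewrite (_ : interp tau phi n l = (fun y => r * phi n.+1 y + (1 - r) * phi n y)).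
  by rewrite grad_comb// -/r scalerBl scale1r scalerBr addrCA addrC -addrA [_ + grad _ _]addrC.
by apply/funext => y; rewrite /interp -/r /GRing.scale/=; ring.
Qed.

Lemma dot_matvec (A : 'M[R]_d) (a b : 'rV[R]_d) :
  dot (matvec A a) b = (b *m (A *m a^T)) 0 0.
Proof.
rewrite /dot big_ord1 [RHS]mxE; apply: eq_bigr => i _.
by rewrite /matvec [X in X * _]mxE mulrC.
Qed.

(** Symmetry of the Korteweg stress matches its term in the entropy equation, where it acts on the
    velocity, with that in the momentum equation, where it acts on the temperature gradient. *)
Lemma dot_matvec_sym (A : 'M[R]_d) (a b : 'rV[R]_d) : A^T = A ->
  dot (matvec A a) b = dot (matvec A b) a.
Proof.
move=> As; rewrite !dot_matvec -[in RHS](trmxK a) -{1}As.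
by rewrite -trmx_mul mulmxA -[in LHS](trmxK b) -trmx_mul mxE trmxK.
Qed.

Lemma matvecDl (A B : 'M[R]_d) a : matvec (A + B) a = matvec A a + matvec B a.
Proof. by rewrite /matvec mulmxDl linearD. Qed.

Lemma matvecZl k (A : 'M[R]_d) a : matvec (k *: A) a = k *: matvec A a.
Proof. by rewrite /matvec -scalemxAl linearZ. Qed.

Lemma matvec_scalar k a : matvec (k%:M : 'M[R]_d) a = k *: a.
Proof. by rewrite /matvec mul_scalar_mx linearZ/= trmxK. Qed.

Lemma trmx_korteweg kappa phi theta n x :
  (@korteweg R d kappa phi theta n x)^T = korteweg kappa phi theta n x.
Proof. by rewrite /korteweg linearZ/= trmx_mul trmxK. Qed.

End gradients.

Section integrals.
Context (R : realType) (d : nat) (I : finType) (mesh : I -> 'I_d.+1 -> 'rV[R]_d).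
Implicit Types g h : 'rV[R]_d -> R.

(** Merging the terms of an equation into one integrable function of integral zero lets the
    equations be combined pointwise. *)
Lemma balance_sum (gs : seq ('rV[R]_d -> R)) : balance mesh gs ->
  integrable_h mesh (fun x => \sum_(g <- gs) g x) /\ int_h mesh (fun x => \sum_(g <- gs) g x) = 0.
Proof.
move=> [igs sgs]; have mE := measurable_elements mesh.
have E : (fun x => \sum_(g <- gs) g x) = (fun x => \sum_(i < size gs) nth (cst 0) gs i x).
  by apply/funext => x; rewrite (big_nth (cst 0)) big_mkord.
rewrite E; split; first by apply: integrable_sumR => // i; exact: igs.
rewrite /int_h Rintegral_sum//; last by move=> i; exact: igs.
by rewrite -[RHS]sgs (big_nth (cst 0)) big_mkord.
Qed.

(** Serves both to advance a quantity by one time step and, with factor 1 or -1, to add or subtract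
    equations. Integrability is passed along with the value. *)
Lemma int_h_step (tau : R) g h S : (forall x, elements mesh x -> h x = g x + tau * S x) ->
  integrable_h mesh g -> integrable_h mesh S ->
  integrable_h mesh h /\ int_h mesh h = int_h mesh g + tau * int_h mesh S.
Proof.
move=> hE ig iS; have mE := measurable_elements mesh.
have iZ := integrable_EFinZ tau mE iS; split.
  apply: eq_integrable (integrable_EFinD mE ig iZ) => //.
  by move=> x; rewrite inE => /hE /= ->.
rewrite /int_h -RintegralZl// -RintegralD//.
by apply: eq_Rintegral => x; rewrite inE => /hE.
Qed.

Lemma int_hB g h : integrable_h mesh g -> integrable_h mesh h ->
  integrable_h mesh (fun x => g x - h x) /\
  int_h mesh (fun x => g x - h x) = int_h mesh g - int_h mesh h.
Proof.
move=> ig ih; have [|i1 ->] := @int_h_step (-1) g (fun x => g x - h x) h _ ig ih.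
  by move=> x _; rewrite mulN1r.
by rewrite mulN1r.
Qed.

End integrals.

(** The interpolants trace a segment with slopes [dtau phi], [grad (dtau phi)] and [dtau s], along
    which the integrals of the partial derivatives are [tau] times their means. The gradient
    commutes with interpolation because [phi] is derivable at [x] at both time levels. *)
Lemma internal_energy_dtau (R : realType) (d : nat) (f : R -> R -> R) (kappa : R -> R) (tau : R)
    (phi s : nat -> 'rV[R]_d -> R) (n : nat) (x : 'rV[R]_d) :
  admissible_potential f -> admissible_kappa kappa -> 0 < tau ->
  (forall v, derivable (phi n.+1) x v) -> (forall v, derivable (phi n) x v) ->
  (forall l, l \in `[tgrid tau n, tgrid tau n.+1] -> state_in_domain f kappa tau phi s n l x) ->
  internal_energy f kappa (phi n.+1 x) (grad (phi n.+1) x) (s n.+1 x) =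
  internal_energy f kappa (phi n x) (grad (phi n) x) (s n x) +
  tau * (dtau tau phi n x * mean_e_phi f kappa tau phi s n x +
    dot (mean_e_grad f kappa tau phi s n x) (grad (dtau tau phi n) x) +
    dtau tau s n x * mean_e_s f kappa tau phi s n x).
Proof.
move=> hf hk tau0 d1 d0 dom.
have tauN0 : tau != 0 by rewrite gt_eqF.
have tS : tgrid tau n.+1 = tgrid tau n + tau by rewrite /tgrid -natr1 mulrDl mul1r.
(* The segment is parametrized by absolute time [l], so its base point is the value extrapolated to
   time 0. *)
have interpE (g : nat -> 'rV[R]_d -> R) l :
    interp tau g n l x = g n x - tgrid tau n * dtau tau g n x + l * dtau tau g n x.
  by rewrite /interp /dtau /GRing.scale/=; field.
set be := grad (dtau tau phi n) x.
have gradE l : grad (interp tau phi n l) x =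
    grad (phi n) x - tgrid tau n *: be + l *: be.
  rewrite grad_interp// /be grad_dtau//.
  by apply/rowP => j; rewrite !mxE; field.
have t01 : tgrid tau n < tgrid tau n.+1 by rewrite tS ltrDl.
have dom' l : l \in `[tgrid tau n, tgrid tau n.+1] -> energy_domain f kappa
    (phi n x - tgrid tau n * dtau tau phi n x + l * dtau tau phi n x)
    (grad (phi n) x - tgrid tau n *: be + l *: be)
    (s n x - tgrid tau n * dtau tau s n x + l * dtau tau s n x).
  by move=> /dom; rewrite /state_in_domain !interpE gradE.
have := @internal_energy_increment R d f kappa hf hk
  (phi n x - tgrid tau n * dtau tau phi n x) (dtau tau phi n x)
  (s n x - tgrid tau n * dtau tau s n x) (dtau tau s n x)
  (grad (phi n) x - tgrid tau n *: be) be (tgrid tau n) (tgrid tau n.+1) t01 dom'.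
rewrite /=.
have meanE e' : \int[lebesgue_measure]_(l in `[tgrid tau n, tgrid tau n.+1])
     e' (phi n x - tgrid tau n * dtau tau phi n x + l * dtau tau phi n x)
        (grad (phi n) x - tgrid tau n *: be + l *: be)
        (s n x - tgrid tau n * dtau tau s n x + l * dtau tau s n x) =
   tau * time_mean tau phi s n e' x.
  rewrite /time_mean mulVKf//.
  by apply: eq_Rintegral => l _; rewrite !interpE gradE.
rewrite (meanE (denergy_phi f kappa)) (meanE (denergy_s f kappa)).
have -> : \row_i \int[lebesgue_measure]_(l in `[tgrid tau n, tgrid tau n.+1])
     denergy_grad f kappa (phi n x - tgrid tau n * dtau tau phi n x + l * dtau tau phi n x)
        (grad (phi n) x - tgrid tau n *: be + l *: be)
        (s n x - tgrid tau n * dtau tau s n x + l * dtau tau s n x) 0 i =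
   tau *: mean_e_grad f kappa tau phi s n x.
  apply/rowP => i; rewrite !mxE.
  exact: (meanE (fun a b c => denergy_grad f kappa a b c 0 i)).
rewrite -!gradE -!interpE dotZl.
have r0 : (tgrid tau n - tgrid tau n) / tau = 0 by rewrite subrr mul0r.
have r1 : (tgrid tau n.+1 - tgrid tau n) / tau = 1 by rewrite tS addrC addKr divff.
have i0 (g : nat -> 'rV[R]_d -> R) : interp tau g n (tgrid tau n) = g n.
  by apply/funext => y; rewrite /interp r0 scale0r add0r.
have i1 (g : nat -> 'rV[R]_d -> R) : interp tau g n (tgrid tau n.+1) = g n.+1.
  by apply/funext => y; rewrite /interp r1 scale1r subrK.
have aux (e1 e0 a m1 D b m2 : R) : e1 - e0 = a * (tau * m1) + tau * D + b * (tau * m2) ->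
    e1 = e0 + tau * (a * m1 + D + b * m2).
  by move=> h; rewrite -[e1](subrK e0) h; ring.
by rewrite !i0 !i1 => /aux.
Qed.

(** * Conservation laws *)

Section conservation.
Context (R : realType) (d : nat) (L : 'rV[R]_d) (I : finType)
  (mesh : I -> 'I_d.+1 -> 'rV[R]_d) (f : R -> R -> R) (kappa : R -> R)
  (M N K eta : R -> R -> R) (tau : R) (n : nat)
  (phi mu s theta p : nat -> 'rV[R]_d -> R) (u : nat -> 'rV[R]_d -> 'rV[R]_d).
Hypotheses (hmesh : periodic_conforming_mesh L mesh) (tau0 : 0 < tau)
  (Vphi0 : Vh L mesh (phi n)) (Vs0 : Vh L mesh (s n)) (Xu0 : Xh L mesh (u n))
  (Vphi1 : Vh L mesh (phi n.+1)) (Vs1 : Vh L mesh (s n.+1)) (Xu1 : Xh L mesh (u n.+1))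
  (Vmu : Vh L mesh (mu n.+1)) (Vtheta : Vh L mesh (theta n.+1)) (Qp : Qh L mesh (p n.+1))
  (theta0 : forall x, Omega L x -> 0 < theta n.+1 x)
  (sol : solves_scheme L mesh f kappa M N K eta tau phi mu s theta p u n).

Let Edrv g : Vh L mesh g -> forall x, elements mesh x -> forall v, derivable g x v.
Proof. by move=> Vg x ex v; exact: lagrange_derivable Vg ex. Qed.

Let near_theta x : elements mesh x -> \forall y \near x, 0 < theta n.+1 y.
Proof.
move=> ex; have := open_nbhs_nbhs (conj (@open_elements R d I mesh) ex).
by apply: filterS => y /(elements_Omega hmesh)/theta0.
Qed.

Let Vdtau g : Vh L mesh (g n.+1) -> Vh L mesh (g n) -> Vh L mesh (dtau tau g n).
Proof.
move=> V1 V0; have := lagrange_comb tau^-1 (- tau^-1) V1 V0.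
by congr Defs.lagrange; apply/funext => x; rewrite /dtau /GRing.scale/=; ring.
Qed.

Let Xmid : Xh L mesh (mid u n).
Proof.
have := Xh_comb 2^-1 2^-1 Xu1 Xu0.
by congr Xh; apply/funext => x; rewrite /mid scalerDr.
Qed.

Let dtauE (g : nat -> 'rV[R]_d -> R) x : g n.+1 x = g n x + tau * dtau tau g n x.
Proof. by rewrite /dtau /GRing.scale/= mulrA divff ?gt_eqF// mul1r addrC subrK. Qed.

(** Tested with 1, the transport and diffusion terms vanish with the gradient and the source
    vanishes with [N]; only [dtau phi] is left. *)
Lemma mass_step : (forall a b : R, 0 < b -> N a b = 0) ->
  int_h mesh (phi n.+1) = int_h mesh (phi n).
Proof.
move=> N0; have [[/(_ _ (Vh_cst1 L mesh))/balance_sum[iS jS] _ _ _] _] := sol.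
set S := (fun x => _) in iS jS.
have [x ex||_ ->] := @int_h_step R d I mesh tau (phi n) (phi n.+1) S _ _ iS.
- rewrite /S !big_cons big_nil grad_cst !dot0r /coef N0.
    by rewrite !mul0r oppr0 !addr0 mulr1; exact: dtauE.
  exact/theta0/(elements_Omega hmesh).
- exact: lagrange_integrable Vphi0.
- by rewrite jS mulr0 addr0.
Qed.

(** Tested with 1, the integrand [S] of the entropy equation is [dtau s] minus the production
    density. Since [S] integrates to zero, the production is the integral of [dtau s]. *)
Lemma entropy_step : int_h mesh (s n.+1) = int_h mesh (s n) +
  tau * entropy_production mesh M N K eta phi mu theta u n.
Proof.
have [[_ _ /(_ _ (Vh_cst1 L mesh))/balance_sum[iS jS] _] _] := sol.
set S := (fun x => _) in iS jS.
have mE := measurable_elements mesh.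
have iD : integrable_h mesh (dtau tau s n) by apply: lagrange_integrable (Vdtau Vs1 Vs0).
have [iP jP] := int_hB iD iS.
rewrite jS subr0 in jP.
have -> : entropy_production mesh M N K eta phi mu theta u n = int_h mesh (dtau tau s n).
  rewrite -jP; apply: eq_Rintegral => x _.
  rewrite /S !big_cons big_nil grad_cst scaler0 !dot0r !dotZl.
  rewrite (_ : (fun y => cst 1 y * mu n.+1 y / theta n.+1 y) = mu_theta mu theta n); last first.
    by apply/funext => y; rewrite /mu_theta mul1r.
  rewrite [cst 1 x * mu n.+1 x / _](_ : _ = mu_theta mu theta n x); last first.
    by rewrite /mu_theta mul1r.
  rewrite real_normK ?num_real//.
  move: (dot _ _) (dot _ _) (dot _ _) (mu_theta _ _ _ _) => A B C D /=.
  by ring.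
have [x _||_ ->//] := @int_h_step R d I mesh tau (s n) (s n.+1) (dtau tau s n) _ _ iD.
- exact: dtauE.
- exact: lagrange_integrable Vs0.
Qed.

(** Difference of two squares: pairing the increment with the midpoint gives exactly the change of
    kinetic energy. *)
Lemma dot_dtau_mid x : dot (dtau tau u n x) (mid u n x) =
  tau^-1 * (2^-1 * dot (u n.+1 x) (u n.+1 x) - 2^-1 * dot (u n x) (u n x)).
Proof.
rewrite /dtau /mid !(dotZl, dotZr, dotDl, dotDr, dotNl, dotNr) (dotC (u n x) (u n.+1 x)).
by ring.
Qed.

Hypotheses (hf : admissible_potential f) (hk : admissible_kappa kappa)
  (dom : forall (l : R) x, l \in `[tgrid tau n, tgrid tau n.+1] ->
     elements mesh x -> state_in_domain f kappa tau phi s n l x).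

(** Integrability of the new energy density belongs to the conclusion, so that the step can be
    iterated from the initial time. *)
Lemma energy_step : integrable_h mesh (total_energy_density f kappa phi s u n) ->
  integrable_h mesh (total_energy_density f kappa phi s u n.+1) /\
  int_h mesh (total_energy_density f kappa phi s u n.+1) =
    int_h mesh (total_energy_density f kappa phi s u n).
Proof.
move=> i0.
have [[/(_ _ Vmu)/balance_sum[iS1 jS1] /(_ _ (Vdtau Vphi1 Vphi0))/balance_sum[iS2 jS2]
  /(_ _ Vtheta)/balance_sum[iS3 jS3] /(_ _ (Vdtau Vs1 Vs0))/balance_sum[iS4 jS4]]
  [/(_ _ Xmid)/balance_sum[iS5 jS5] /(_ _ Qp)/balance_sum[iS6 jS6]]] := sol.
set S1 := (fun x => _) in iS1 jS1; set S2 := (fun x => _) in iS2 jS2.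
set S3 := (fun x => _) in iS3 jS3; set S4 := (fun x => _) in iS4 jS4.
set S5 := (fun x => _) in iS5 jS5; set S6 := (fun x => _) in iS6 jS6.
have mE := measurable_elements mesh.
have [iA jA] := int_hB iS1 iS2; have [iB jB] := int_hB iS3 iS4.
(* The six tested equations are collected into [S1 - S2 + S3 - S4 + S5 + S6], whose integral is
   zero; the factors 1 come from [int_h_step]. *)
have [x _|iC jC] := @int_h_step R d I mesh 1 _
  (fun x => (S1 x - S2 x) + 1 * (S3 x - S4 x)) _ _ iA iB.
  by [].
have [x _|iD jD] := @int_h_step R d I mesh 1 _ (fun x => S5 x + 1 * S6 x) _ _ iS5 iS6.
  by [].
have [x _|iF jF] := @int_h_step R d I mesh 1 _ (fun x => ((S1 x - S2 x) + 1 * (S3 x - S4 x))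
   + 1 * (S5 x + 1 * S6 x)) _ _ iC iD.
  by [].
rewrite jC jD jA jB jS1 jS2 jS3 jS4 jS5 jS6 subrr !(mulr0, addr0) in jF.
(* It remains to show pointwise that this combination, times [tau], is the increment of the energy
   density. *)
suff E x : elements mesh x -> total_energy_density f kappa phi s u n.+1 x =
    total_energy_density f kappa phi s u n x +
    tau * (((S1 x - S2 x) + 1 * (S3 x - S4 x)) + 1 * (S5 x + 1 * S6 x)).
  have [i1 j1] := int_h_step E i0 iF.
  by split=> //; rewrite j1 jF mulr0 addr0.
move=> ex {iA jA iB jB iC jC iD jD iF jF iS1 jS1 iS2 jS2 iS3 jS3 iS4 jS4 iS5 jS5 iS6 jS6}.
have th0 : 0 < theta n.+1 x by exact/theta0/(elements_Omega hmesh).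
have thN0 : theta n.+1 x != 0 by rewrite gt_eqF.
rewrite /S1 /S2 /S3 /S4 /S5 /S6 !big_cons !big_nil.
(* With [omega = theta] the heat flux is paired with the gradient of the constant 1. *)
have -> : grad (fun y => theta n.+1 y / theta n.+1 y) x = 0.
  rewrite -[RHS](grad_cst 1 x); apply: near_eq_grad.
  by apply: filterS (near_theta ex) => y y0; rewrite divff// gt_eqF.
(* The diffusive production is thus paired with [grad mu] and cancels the diffusion term of the
   phase equation tested with [mu]. *)
have -> : grad (fun y => theta n.+1 y * mu n.+1 y / theta n.+1 y) x = grad (mu n.+1) x.
  apply: near_eq_grad; apply: filterS (near_theta ex) => y y0.
  by rewrite mulrAC divff ?mul1r// gt_eqF.
(* The product rule splits the capillary term of the potential equation: the part with [grad theta]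
   cancels its counterpart in the entropy equation, and the part with [grad (dtau phi)] enters the
   increment of [e]. *)
rewrite grad_mul; [|by apply: Edrv ex; exact: Vdtau|exact: Edrv ex].
rewrite [theta n.+1 x * mu n.+1 x / theta n.+1 x]mulrAC divff// mul1r.
rewrite /total_energy_density.
rewrite (internal_energy_dtau hf hk tau0 (Edrv Vphi1 ex) (Edrv Vphi0 ex)); last first.
  by move=> l lt; exact: dom.
rewrite dot_dtau_mid.
have := dot_matvec_sym (mid u n x) (grad (theta n.+1) x) (trmx_korteweg kappa phi theta n x).
(* All pointwise quantities are generalized to variables; after expansion by bilinearity the claim
   is a rational identity with denominators [tau] and [th]. *)
move: (dot (u n.+1 x) (u n.+1 x)) (dot (u n x) (u n x)) (internal_energy _ _ _ _ _) => U1 U0 E0.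
move: (korteweg _ _ _ _ _) (symgrad _ x) (dot (advect _ _ x) _) => Kw Du adv.
move: (mid u n x) (grad (theta n.+1) x) (grad (mu n.+1) x) => um gth gmu.
move: (grad (dtau tau phi n) x) (grad (mu_theta mu theta n) x) => gdphi gmuth.
move: (grad _ x) (mean_e_grad _ _ _ _ _ _ _) (mean_e_phi _ _ _ _ _ _ _) (mean_e_s _ _ _ _ _ _ _)
  => gth1 meg mephi mes.
move=> sym; have tauN0 : tau != 0 by rewrite gt_eqF.
rewrite matvecDl matvecZl matvec_scalar !(dotZl, dotZr, dotDl, dotDr, dot0r) sym.
rewrite (dotC gmu um) (dotC gth um).
move: thN0; move: (theta n.+1 x) (mu n.+1 x) (mu_theta _ _ _ _) (p n.+1 x) (div _ x)
  => th m mth q dv thN0.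
move: (dtau _ phi _ _) (dtau _ s _ _) (mid phi _ _) (mid s _ _) => dphi ds mphi ms.
move: (coef _ _ M _ _) (coef _ _ N _ _) (coef _ _ K _ _) (coef _ _ eta _ _) => cM cN cK ceta.
move: (dot _ _) (dot _ _) (dot _ _) (dot _ _) (dot _ _) (dot _ _) => A1 A2 A3 A4 A5 A6.
by field; rewrite tauN0 thN0.
Qed.


End conservation.

(** * Iteration over the time levels *)

Theorem theorem4p2 (R : realType) (d : nat) (L : 'rV[R]_d)
    (I : finType) (mesh : I -> 'I_d.+1 -> 'rV[R]_d)
    (f : R -> R -> R) (kappa : R -> R) (M N K eta : R -> R -> R)
    (Tend tau : R) (nT : nat)
    (phi mu s theta p : nat -> 'rV[R]_d -> R) (u : nat -> 'rV[R]_d -> 'rV[R]_d) :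
  (1 <= d <= 3)%N -> (forall i, 0 < L 0 i) ->
  periodic_conforming_mesh L mesh ->
  0 < tau -> Tend = nT%:R * tau ->
  admissible_potential f -> admissible_kappa kappa ->
  (forall a b : R, 0 < b -> 0 <= M a b) -> (forall a b : R, 0 < b -> 0 <= N a b) ->
  (forall a b : R, 0 < b -> 0 <= K a b) -> (forall a b : R, 0 < b -> 0 <= eta a b) ->
  Vh L mesh (phi 0%N) -> Vh L mesh (s 0%N) -> Xh L mesh (u 0%N) ->
  (forall n, (n < nT)%N ->
     [/\ Vh L mesh (phi n.+1), Vh L mesh (mu n.+1), Vh L mesh (s n.+1) &
         Vh L mesh (theta n.+1)] /\ (Xh L mesh (u n.+1) /\ Qh L mesh (p n.+1))) ->
  (forall n, (n < nT)%N ->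
     solves_scheme L mesh f kappa M N K eta tau phi mu s theta p u n) ->
  (forall k x, (1 <= k <= nT)%N -> Omega L x -> 0 < theta k x) ->
  (forall (n : nat) (l : R) x, (n < nT)%N -> l \in `[tgrid tau n, tgrid tau n.+1] ->
     elements mesh x -> state_in_domain f kappa tau phi s n l x) ->
  integrable_h mesh (total_energy_density f kappa phi s u 0) ->
  forall n, (n < nT)%N ->
  [/\ (forall a b : R, 0 < b -> N a b = 0) ->
        int_h mesh (phi n.+1) = int_h mesh (phi 0%N),
      int_h mesh (s n.+1) = int_h mesh (s 0%N)
        + tau * \sum_(k < n.+1)
            entropy_production mesh M N K eta phi mu theta u k &
      int_h mesh (total_energy_density f kappa phi s u n.+1)
        = int_h mesh (total_energy_density f kappa phi s u 0)].
Proof.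
move=> _ _ hmesh tau0 _ hf hk _ _ _ _ Vphi0 Vs0 Xu0 Vn sol theta0 dom i0 n nT_n.
(* Level 0 comes from the initial data, the later levels from the scheme. *)
have Vphi k : (k <= nT)%N -> Vh L mesh (phi k).
  by case: k => [//|k] /Vn[[]].
have Vs k : (k <= nT)%N -> Vh L mesh (s k).
  by case: k => [//|k] /Vn[[]].
have Xu k : (k <= nT)%N -> Xh L mesh (u k).
  by case: k => [//|k] /Vn[_ []].
have Vtheta k : (k < nT)%N -> Vh L mesh (theta k.+1) by move=> /Vn[[]].
have Vmu k : (k < nT)%N -> Vh L mesh (mu k.+1) by move=> /Vn[[]].
have th0 k : (k < nT)%N -> forall x, Omega L x -> 0 < theta k.+1 x.
  by move=> kn x; apply: theta0.
split.
- move=> N0.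
  have step k (kn : (k < nT)%N) : int_h mesh (phi k.+1) = int_h mesh (phi k).
    exact: mass_step hmesh tau0 (Vphi _ (ltnW kn)) (th0 _ kn) (sol _ kn) N0.
  elim: n nT_n => [|n IH] nT_n; first exact: step.
  by rewrite step// IH// ltnW.
- have step k (kn : (k < nT)%N) : int_h mesh (s k.+1) = int_h mesh (s k) +
      tau * entropy_production mesh M N K eta phi mu theta u k.
    exact: entropy_step hmesh tau0 (Vs _ (ltnW kn)) (Vs _ kn) (sol _ kn).
  elim: n nT_n => [|n IH] nT_n; first by rewrite big_ord1 step.
  by rewrite big_ord_recr/= mulrDr addrA -IH ?step// ltnW.
have step k (kn : (k < nT)%N) := energy_step hmesh tau0
  (Vphi _ (ltnW kn)) (Vs _ (ltnW kn)) (Xu _ (ltnW kn)) (Vphi _ kn) (Vs _ kn) (Xu _ kn)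
  (Vmu _ kn) (Vtheta _ kn) (proj2 (proj2 (Vn _ kn))) (th0 _ kn) (sol _ kn) hf hk
  (fun l x => @dom k l x kn).
(* The induction also carries the integrability of the energy density, which each application of
   [energy_step] consumes and returns. *)
suff [] : integrable_h mesh (total_energy_density f kappa phi s u n.+1) /\
    int_h mesh (total_energy_density f kappa phi s u n.+1) =
    int_h mesh (total_energy_density f kappa phi s u 0) by [].
elim: n nT_n => [|n IH] nT_n; first exact: step.
by have [i1 <-] := IH (ltnW nT_n); exact: step.
Qed.
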